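(* Let $v$ satisfy Assumption (V) (see context) with $r_{\rm hc}>0$, and let $m\in\mathbb N\cup\{\infty\}$. There exists $c>0$ such that for all $\beta,p>0$, all smooth $f,g:\mathbb R_+\to\mathbb R$, and all $i\ne j$ in $\mathbb Z$, $$\Bigl|\tilde\mu_\beta(f_ig_j)-\tilde\mu_\beta(f_i)\,\tilde\mu_\beta(g_j)\Bigr|\le\frac{c}{\beta\,|i-j|^s}\Bigl(\tilde\mu_\beta\bigl({f_i'}^2\bigr)\,\tilde\mu_\beta\bigl({g_j'}^2\bigr)\Bigr)^{1/2}.$$
   Context: $\mathbb N=\{1,2,\ldots\}$, $\mathbb R_+=(0,\infty)$. Assumption (V): $v:(0,\infty)\to\mathbb R\cup\{+\infty\}$ equals $+\infty$ on $(0,r_{\rm hc}]$ for some $r_{\rm hc}\ge 0$ and is $C^2$ on $(r_{\rm hc},\infty)$. There exist $r_{\rm hc}<z_{\min}<z_{\max}<2z_{\min}$ and $\alpha_1,\alpha_2>0$, $s>2$ such that: (i) $z_{\max}$ is the unique minimizer of $v$ and $v(z_{\max})<0$; $v$ is decreasing on $(0,z_{\max})$ and increasing and non-positive on $(z_{\max},\infty)$. (ii) $v(z)\ge-\alpha_1z^{-s}$ for all $z>0$, and $v(z)+v(z_{\max})-2\alpha_1\sum_{n=2}^\infty(nz)^{-s}>0$ for all $z<z_{\min}$. (iii) $v''$ is decreasing on $[z_{\min},z_{\max}]$ and increasing and non-positive on $[2z_{\min},\infty)$. (iv) $v''(z)\ge-\alpha_2z^{-s-2}$ for all $z>r_{\rm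 hc}$, and $v''(z_{\max})+\sum_{n=2}^\infty n^2v''(nz_{\min})>0$. Restricted Gibbs measures: $\mathcal E_N(z_1,\ldots,z_{N-1})=\sum_{1\le i<j\le N,\,|i-j|\le m}v(z_i+\cdots+z_{j-1})+p\sum_{j=1}^{N-1}z_j$. For $\beta,p>0$ let $\tilde\mu_\beta^{(N)}$ be the probability measure on $[z_{\min},z_{\max}]^{N-1}$ with Lebesgue density proportional to $e^{-\beta\mathcal E_N}$. $\tilde\mu_\beta$ is the shift-invariant probability measure on $[z_{\min},z_{\max}]^{\mathbb Z}$ obtained as the (bulk) thermodynamic limit: for all $k\in\mathbb N$, all continuous $F$ on $[z_{\min},z_{\max}]^k$ and all sequences $i_N$ with $i_N\to\infty$, $N-i_N\to\infty$, $\int F(z_{i_N+1},\ldots,z_{i_N+k})\,d\tilde\mu_\beta^{(N)}\to\int F(z_1,\ldots,z_k)\,d\tilde\mu_\beta$ as $N\to\infty$. Notation: $f_i((z_j)_{j\in\mathbb Z})=f(z_i)$, $f_i'((z_j)_{j\in\mathbb Z})=f'(z_i)$; $\tilde\mu_\beta(F)=\int F\,d\tilde\mu_\beta$. *)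

(* Defs.v *)
From HB Require Import structures.
From mathcomp Require Import all_boot all_order all_algebra.
From mathcomp Require Import all_classical all_reals all_analysis.

Set Implicit Arguments.
Unset Strict Implicit.
Unset Printing Implicit Defensive.

Import Order.TTheory GRing.Theory Num.Theory.
Import numFieldNormedType.Exports.

Local Open Scope classical_set_scope.
Local Open Scope ring_scope.

(* The pair potential v : R -> \bar R is only meaningful on (0, +oo); since it
   never takes the value -oo there, its derivatives on (r_hc, +oo) are those of
   fine \o v.  "Increasing" and "decreasing" are non-strict: v is constantly
   +oo on (0, r_hc]. *)
Definition potential_d2 (R : realType) (v : R -> \bar R) : R -> R :=
  derive1n 2 (fine \o v).

Record potential_assumption (R : realType) (v : R -> \bar R)
    (r_hc z_min z_max alpha1 alpha2 s : R) : Prop := PotentialAssumption {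
  pa_rhc_ge0 : 0 <= r_hc ;
  pa_hardcore : forall z : R, 0 < z -> z <= r_hc -> v z = +oo%E ;
  pa_finite : forall z : R, r_hc < z -> v z \is a fin_num ;
  pa_C2 : forall z : R, r_hc < z ->
    [/\ derivable (fine \o v) z 1,
        derivable (derive1 (fine \o v)) z 1
      & {for z, continuous (potential_d2 v)}] ;
  pa_order : [/\ r_hc < z_min, z_min < z_max & z_max < 2 * z_min] ;
  pa_alpha1 : 0 < alpha1 ;
  pa_alpha2 : 0 < alpha2 ;
  pa_s : 2 < s ;
  pa_min : forall z : R, 0 < z -> z != z_max -> (v z_max < v z)%E ;
  pa_min_lt0 : (v z_max < 0)%E ;
  pa_decr : forall x y : R, 0 < x -> x <= y -> y < z_max -> (v y <= v x)%E ;
  pa_incr : forall x y : R, z_max < x -> x <= y -> (v x <= v y)%E ;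
  pa_npos : forall z : R, z_max < z -> (v z <= 0)%E ;
  pa_lower : forall z : R, 0 < z -> ((- (alpha1 * z `^ (- s)))%:E <= v z)%E ;
  pa_barrier : forall z : R, 0 < z -> z < z_min ->
    (0 < v z + v z_max
         - (2 * alpha1)%:E * \sum_(2 <= n <oo) ((n%:R * z) `^ (- s))%:E)%E ;
  pa_d2_decr : forall x y : R, z_min <= x -> x <= y -> y <= z_max ->
    potential_d2 v y <= potential_d2 v x ;
  pa_d2_incr : forall x y : R, 2 * z_min <= x -> x <= y ->
    potential_d2 v x <= potential_d2 v y ;
  pa_d2_npos : forall z : R, 2 * z_min <= z -> potential_d2 v z <= 0 ;
  pa_d2_lower : forall z : R, r_hc < z ->
    - (alpha2 * z `^ (- s - 2)) <= potential_d2 v z ;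
  pa_d2_convex :
    (0 < (potential_d2 v z_max)%:E
         + \sum_(2 <= n <oo) (n%:R ^+ 2 * potential_d2 v (n%:R * z_min))%:E)%E
}.

Definition smooth_on_pos (R : realType) (f : R -> R) : Prop :=
  forall (n : nat) (x : R), 0 < x -> derivable (derive1n n f) x 1.

Section lebesgue_measure_tuple.
Variable R : realType.

(* Lebesgue measure on R^n, built by pushing the product measure on R * R^n
   forward along (x, t) |-> x :: t; R^0 carries the unit mass. *)
Section cons.
Variables (n : nat) (nu : {sigma_finite_measure set (n.-tuple R) -> \bar R}).

Definition tuple_cons (p : R * n.-tuple R) : n.+1.-tuple R :=
  [tuple of p.1 :: p.2].

Lemma measurable_tuple_cons : measurable_fun [set: R * n.-tuple R] tuple_cons.
Proof. exact: measurable_cons. Qed.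

Definition lebesgue_cons : set (n.+1.-tuple R) -> \bar R :=
  pushforward (lebesgue_measure \x nu)%E tuple_cons.

Let lebesgue_cons0 : lebesgue_cons set0 = 0%E.
Proof. by rewrite /lebesgue_cons /pushforward preimage_set0 measure0. Qed.

Let lebesgue_cons_ge0 A : (0 <= lebesgue_cons A)%E.
Proof. by rewrite /lebesgue_cons /pushforward; exact: measure_ge0. Qed.

Let lebesgue_cons_sigma_additive : semi_sigma_additive lebesgue_cons.
Proof.
have mpre (X : set (n.+1.-tuple R)) : measurable X ->
    measurable (tuple_cons @^-1` X).
  by move=> mX; rewrite -[X in measurable X]setTI; exact: measurable_tuple_cons.
move=> F mF tF mUF; rewrite /lebesgue_cons /pushforward preimage_bigcup.
apply: measure_semi_sigma_additive.
- by move=> k; exact: mpre.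
- by apply/trivIsetP => /= i j _ _ ij; rewrite -preimage_setI;
    move/trivIsetP : tF => -> //; rewrite preimage_set0.
- by rewrite -preimage_bigcup; exact: mpre.
Qed.

HB.instance Definition _ := isMeasure.Build _ _ _ lebesgue_cons
  lebesgue_cons0 lebesgue_cons_ge0 lebesgue_cons_sigma_additive.

Let lebesgue_cons_sigma_finite : sigma_finite setT lebesgue_cons.
Proof.
pose uncons (t : n.+1.-tuple R) : R * n.-tuple R :=
  (thead t, [tuple of behead t]).
have unconsK : cancel uncons tuple_cons.
  by move=> t; rewrite /uncons /tuple_cons/= [RHS]tuple_eta.
have consK : cancel tuple_cons uncons.
  by move=> [x t]; congr pair => //; exact: val_inj.
have mu : measurable_fun [set: n.+1.-tuple R] uncons.
  apply/measurable_fun_pair => //=; first exact: measurable_tnth.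
  exact: measurable_behead.
have [F FT Foo] : sigma_finite setT (lebesgue_measure \x nu)%E.
  have /sigma_finiteP[A [AT ndA Aoo]] :=
    sigma_finiteT (@lebesgue_measure R).
  have /sigma_finiteP[B [BT ndB Boo]] := sigma_finiteT nu.
  exists (fun k => A k `*` B k).
    rewrite -setXTT AT BT predeqE => -[x y]; split.
      move=> [/= [k _ Akx] [l _ Bly]]; exists (maxn k l) => //; split.
      - by move: x Akx; exact/subsetPset/ndA/leq_maxl.
      - by move: y Bly; exact/subsetPset/ndB/leq_maxr.
    by move=> [k _ []/= ? ?]; split; exists k.
  move=> k; have [? ?] := Aoo k; have [? ?] := Boo k.
  split; first exact: measurableX.
  by rewrite product_measure1E// lte_mul_pinfty// ge0_fin_numE.
exists (fun k => uncons @^-1` F k).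
  by rewrite -preimage_bigcup -FT preimage_setT.
move=> k; have [mF Fk] := Foo k; split.
  by rewrite -[X in measurable X]setTI; exact: mu.
rewrite /lebesgue_cons /pushforward -comp_preimage.
suff -> : uncons \o tuple_cons = id by [].
by apply/funext => p /=; rewrite consK.
Qed.

HB.instance Definition _ := Measure_isSigmaFinite.Build _ _ _ lebesgue_cons
  lebesgue_cons_sigma_finite.

End cons.

Fixpoint lebesgue_tuple (n : nat) :
    {sigma_finite_measure set (n.-tuple R) -> \bar R} :=
  match n with
  | 0 => \d_ ([tuple] : 0.-tuple R)
  | n'.+1 => lebesgue_cons (lebesgue_tuple n')
  end.

End lebesgue_measure_tuple.

Section gibbs.
Variables (R : realType) (v : R -> \bar R) (m : option nat).
Variables (z_min z_max beta p : R).

(* m = None stands for m = infinity. *)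
Definition in_range (k : nat) : bool :=
  if m is Some m' then (k <= m')%N else true.

(* The spacings z_1, ..., z_(N-1) are stored as z`_0, ..., z`_(N-2). *)
Definition energy (N : nat) (z : N.-1.-tuple R) : \bar R :=
  (\sum_(i < N) \sum_(j < N | (i < j)%N && in_range (j - i))
      v (\sum_(i <= l < j) z`_l)%R
   + (p * \sum_(l < N.-1) z`_l)%:E)%E.

Definition boltzmann (N : nat) (z : N.-1.-tuple R) : R :=
  fine (expeR (- (beta%:E * energy z))).

Definition box (n : nat) : set (n.-tuple R) :=
  [set z | forall l : 'I_n, z_min <= tnth z l <= z_max].

(* Expectation under the probability measure on [z_min, z_max]^(N-1) whose
   Lebesgue density is proportional to exp(- beta * energy). *)
Definition gibbs_mean (N : nat) (F : N.-1.-tuple R -> R) : R :=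
  (\int[lebesgue_tuple R N.-1]_(z in @box N.-1) (F z * boltzmann z)) /
  (\int[lebesgue_tuple R N.-1]_(z in @box N.-1) boltzmann z).

End gibbs.

(* R^Z with its product sigma-algebra. *)
Definition cylinders (R : realType) : set (set (int -> R)) :=
  [set A | exists (i : int) (B : set R),
     measurable B /\ A = [set z | B (z i)]].

Definition config (R : realType) := g_sigma_algebraType (@cylinders R).

Definition shift (R : realType) (z : config R) : config R :=
  fun i : int => z (i + 1).

Definition config_box (R : realType) (z_min z_max : R) : set (config R) :=
  [set z | forall i : int, z_min <= z i <= z_max].

Definition row_box (R : realType) (z_min z_max : R) (k : nat) :
    set 'rV[R]_k :=
  [set x | forall l : 'I_k, z_min <= x ord0 l <= z_max].

(* mu, a probability measure on R^Z, is carried by [z_min, z_max]^Z, is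
   shift-invariant, and is the bulk thermodynamic limit of the restricted Gibbs
   measures.  The block z_(i_N + 1), ..., z_(i_N + k) is z`_(i_N), ...,
   z`_(i_N + k - 1); it lies inside the chain for all large N. *)
Definition bulk_limit (R : realType) (v : R -> \bar R) (m : option nat)
    (z_min z_max beta p : R) (mu : probability (config R) R) : Prop :=
  [/\ mu (config_box z_min z_max) = 1%E,
      forall A : set (config R), measurable A ->
        mu (@shift R @^-1` A) = mu A
    & forall (k : nat) (F : 'rV[R]_k -> R) (i_ : nat -> nat),
        (0 < k)%N ->
        {within @row_box R z_min z_max k, continuous F} ->
        i_ N @[N --> \oo] --> \oo ->
        (N - i_ N)%N @[N --> \oo] --> \oo ->
        gibbs_mean v m z_min z_max beta p
          (fun z : N.-1.-tuple R => F (\row_(l < k) z`_(i_ N + l)%N))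
          @[N --> \oo]
        --> \int[mu]_(z in config_box z_min z_max)
              F (\row_(l < k) z (l.+1%:Z))].

Definition mean (R : realType) (z_min z_max : R) (mu : probability (config R) R)
    (F : config R -> R) : R :=
  \int[mu]_(z in config_box z_min z_max) F z.

(* Main.v *)
Require Import Defs.
From HB Require Import structures.
From mathcomp Require Import all_boot all_order all_algebra.
From mathcomp Require Import all_classical all_reals all_analysis.
From mathcomp Require Import measurable_realfun.
From mathcomp Require Import ring lra zify.

Set Implicit Arguments.
Unset Strict Implicit.
Unset Printing Implicit Defensive.

Import Order.TTheory GRing.Theory Num.Theory.
Import numFieldNormedType.Exports.

Local Open Scope classical_set_scope.
Local Open Scope ring_scope.

(* In a finite chain, [- d_a d_b energy >= 0] for [a != b], so the Gibbs weight
   is log-supermodular and the FKG inequality holds.  Let [f] be nondecreasing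
   and [xi_b = cov (f (z_i), z_b)].
   - Integration by parts in [z_a] gives
     [beta cov (f (z_i), d_a energy) <= delta_{ai} E (f' (z_i))]; the boundary
     terms have the right sign, for [a != i] again by FKG.
   - If [A] is an entrywise lower bound of the Hessian, [d_a energy - (A z)_a]
     is nondecreasing in every coordinate, so FKG yields
     [beta A xi <= E (f' (z_i)) e_i].
   - By (iii) and (iv) of Assumption (V), [A] can be chosen as a diagonally
     dominant M-matrix whose entries decay like [|a - b|^(- s)]; a supersolution
     with the same decay and the maximum principle give
     [cov (f (z_i), z_j) <= c / (beta |i - j|^s) E (f' (z_i))].
   - By Hoeffding's formula [cov (f (z_i), g (z_j))] is the integral of
     [f' (s) g' (t)] against the nonnegative kernel
     [cov (1_{z_i >= s}, 1_{z_j >= t})], so [2 f' g' <= l f'^2 + g'^2 / l]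
     reduces the general case to the previous one.
   All constants are independent of the length of the chain. *)

(** * Bounded measurable functions and Fubini's theorem for real-valued integrals *)

Section bounded_measurable.
Context (R : realType).

(** The sign of the mixed derivatives is a matter of lengths: for [a != b], [d_a d_b energy] sums
    [v''] over blocks containing both sites, whose length is at least [2 * z_min], where (iii) makes
    [v''] non-positive. Confining the spacings to [[z_min, z_max]] secures this; the price is the
    boundary terms of the integration by parts. The exponent [s] arises by counting: at most [k]
    blocks of [k] spacings pass through a site, so the entry [(a, b)] of [A] is controlled by the
    sum of [k * k^(- s - 2)] over [k > |a - b|]. The weights [n^2] in (iv) count blocks times sites
    per block, so (iv) says that the row sums of [A] stay above some [delta > 0]. The Gibbs weight
    is extended from the box to all tuples by clamping coordinates. The extension is bounded,
    bounded away from [0] and log-supermodular everywhere, so the general lemmas are stated on the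
    whole space. Nondecreasing functions of one spacing enter as primitives of nonnegative
    functions. *)

Definition bounded_measurable d (T : measurableType d) (F : T -> R) :=
  measurable_fun setT F /\ exists M : R, forall x, `|F x| <= M.

Section closure.
Context d (T : measurableType d).
Implicit Types F G : T -> R.

Lemma bounded_measurable_cst (c : R) : bounded_measurable (fun _ : T => c).
Proof. by split; [exact: measurable_cst|exists `|c|]. Qed.

Lemma bounded_measurableD F G : bounded_measurable F -> bounded_measurable G ->
  bounded_measurable (fun x => F x + G x).
Proof.
move=> [mF [M HM]] [mG [N HN]]; split; first exact: measurable_funD.
by exists (M + N) => x; rewrite (le_trans (ler_normD _ _))// lerD.
Qed.

Lemma bounded_measurableM F G : bounded_measurable F -> bounded_measurable G ->
  bounded_measurable (fun x => F x * G x).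
Proof.
move=> [mF [M HM]] [mG [N HN]]; split; first exact: measurable_funM.
by exists (M * N) => x; rewrite normrM ler_pM.
Qed.

Lemma bounded_measurableZ (c : R) F : bounded_measurable F ->
  bounded_measurable (fun x => c * F x).
Proof. exact/bounded_measurableM/bounded_measurable_cst. Qed.

Lemma bounded_measurableN F : bounded_measurable F ->
  bounded_measurable (fun x => - F x).
Proof.
move=> bF; rewrite (_ : (fun x => - F x) = (fun x => -1 * F x)); last first.
  by apply/funext => x; rewrite mulN1r.
exact: bounded_measurableZ.
Qed.

Lemma bounded_measurableB F G : bounded_measurable F -> bounded_measurable G ->
  bounded_measurable (fun x => F x - G x).
Proof. by move=> bF bG; apply/bounded_measurableD/bounded_measurableN. Qed.

Lemma bounded_measurable_sum (I : Type) (r : seq I) (P : pred I)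
    (F : I -> T -> R) : (forall i, P i -> bounded_measurable (F i)) ->
  bounded_measurable (fun x => \sum_(i <- r | P i) F i x).
Proof.
move=> bF; elim: r => [|i r IH].
  rewrite (_ : (fun _ => _) = fun=> 0); first exact: bounded_measurable_cst.
  by apply/funext => x; rewrite big_nil.
have [Pi|nPi] := boolP (P i).
  rewrite (_ : (fun _ => _) = fun x => F i x + \sum_(i <- r | P i) F i x).
    by apply: bounded_measurableD => //; exact: bF.
  by apply/funext => x; rewrite big_cons Pi.
rewrite (_ : (fun _ => _) = fun x => \sum_(i <- r | P i) F i x) //.
by apply/funext => x; rewrite big_cons (negbTE nPi).
Qed.

Lemma bounded_measurable_comp d' (T' : measurableType d') (F : T' -> R)
    (phi : T -> T') : bounded_measurable F -> measurable_fun setT phi ->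
  bounded_measurable (fun x => F (phi x)).
Proof.
move=> [mF [M HM]] mphi; split; first exact: measurableT_comp.
by exists M => x.
Qed.

Lemma bounded_measurable_integrable (mu : {measure set T -> \bar R})
    (D : set T) F : measurable D -> (mu D < +oo)%E -> bounded_measurable F ->
  mu.-integrable D (EFin \o F).
Proof.
move=> mD fD [mF [M HM]]; apply: measurable_bounded_integrable => //.
  exact: measurable_funTS.
by exists M; split; [exact: num_real|move=> N MN x _ /=; exact: le_trans (HM x) (ltW MN)].
Qed.

End closure.

Section fubini.
Context d1 d2 (T1 : measurableType d1) (T2 : measurableType d2).
Variables (m1 : {sigma_finite_measure set T1 -> \bar R})
          (m2 : {sigma_finite_measure set T2 -> \bar R}).
Variables (D1 : set T1) (D2 : set T2).
Hypotheses (mD1 : measurable D1) (mD2 : measurable D2)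
           (fD1 : (m1 D1 < +oo)%E) (fD2 : (m2 D2 < +oo)%E).
Variable F : T1 * T2 -> R.
Hypothesis bF : bounded_measurable F.

Let bF1 x : bounded_measurable (fun y => F (x, y)).
Proof. by apply: bounded_measurable_comp bF _; exact: pair1_measurable. Qed.

Let bF2 y : bounded_measurable (fun x => F (x, y)).
Proof. by apply: bounded_measurable_comp bF _; exact: pair2_measurable. Qed.

Lemma bounded_measurable_Rintegral :
  bounded_measurable (fun x => \int[m2]_(y in D2) F (x, y)).
Proof.
have [mF [M HM]] := bF; split; last first.
  exists (M * fine (m2 D2)) => x.
  rewrite (le_trans (le_normr_Rintegral _ _))//.
    exact: bounded_measurable_integrable.
  rewrite -Rintegral_cst//; apply: le_Rintegral => //.
  - have [mf [N HN]] := bF1 x.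
    apply: bounded_measurable_integrable => //; split.
      exact: measurableT_comp.
    by exists N => y; rewrite normr_id.
  - exact/bounded_measurable_integrable/bounded_measurable_cst.
(* Adding the bound [M] makes the integrand nonnegative, the case in which Tonelli's theorem yields
   measurability of the partial integral. *)
rewrite (_ : (fun _ => _) = fun x => \int[m2]_(y in D2) (F (x, y) + M)
    - M * fine (m2 D2)); last first.
  apply/funext => x; rewrite RintegralD// ?Rintegral_cst ?addrK//.
    exact: bounded_measurable_integrable.
  exact/bounded_measurable_integrable/bounded_measurable_cst.
apply: measurable_funB; last exact: measurable_cst.
rewrite /Rintegral; apply: measurableT_comp => //.
under eq_fun do rewrite integral_mkcond.
pose f := (fun z => (F z + M)%:E) \_ (setT `*` D2).
rewrite (_ : (fun _ => _) = fubini_F m2 f); last first.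
  apply/funext => x; apply: eq_integral => y _; rewrite /f !patchE.
  by rewrite !in_setX in_setT.
apply: measurable_fun_fubini_tonelli_F.
  apply/(measurable_restrictT _ _).1; first exact: measurableX.
  apply: measurable_funTS; apply/measurable_EFinP.
  by apply: measurable_funD => //; exact: measurable_cst.
move=> z; rewrite /f patchE; case: ifP => _; last exact: lexx.
by rewrite lee_fin -lerBlDr sub0r; have := HM z; rewrite ler_norml => /andP[].
Qed.

Lemma Rintegral_fubini :
  \int[m1]_(x in D1) (\int[m2]_(y in D2) F (x, y)) =
  \int[m2]_(y in D2) (\int[m1]_(x in D1) F (x, y)).
Proof.
pose f := (EFin \o F) \_ (D1 `*` D2).
have intf : (m1 \x m2)%E.-integrable setT f.
  have mD : measurable (D1 `*` D2) by exact: measurableX.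
  apply/(integrable_mkcond _ mD).
  apply: bounded_measurable_integrable => //.
  rewrite [X in (X < _)%E]product_measure1E//.
  by rewrite lte_mul_pinfty// ge0_fin_numE.
have := Fubini intf.
rewrite /Rintegral => E; congr fine.
transitivity (\int[m1]_x \int[m2]_y f (x, y))%E; last first.
  rewrite E [RHS]integral_mkcond; apply: eq_integral => y _.
  rewrite patchE; case: ifPn => yD.
    rewrite fineK; last first.
      by apply: integrable_fin_num => //; exact: bounded_measurable_integrable.
    rewrite [RHS]integral_mkcond; apply: eq_integral => x _.
    by rewrite /f !patchE in_setX yD andbT.
  by rewrite integral0_eq// => x _; rewrite /f patchE in_setX (negbTE yD) andbF.
rewrite [LHS]integral_mkcond; apply: eq_integral => x _.
rewrite patchE; case: ifPn => xD.
  rewrite fineK; last first.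
    by apply: integrable_fin_num => //; exact: bounded_measurable_integrable.
  rewrite [LHS]integral_mkcond; apply: eq_integral => y _.
  by rewrite /f !patchE in_setX xD.
by rewrite integral0_eq// => y _; rewrite /f patchE in_setX (negbTE xD).
Qed.

Lemma Rintegral_product :
  \int[(m1 \x m2)%E]_(z in D1 `*` D2) F z =
  \int[m1]_(x in D1) (\int[m2]_(y in D2) F (x, y)).
Proof.
pose f := (EFin \o F) \_ (D1 `*` D2).
have intf : (m1 \x m2)%E.-integrable setT f.
  have mD : measurable (D1 `*` D2) by exact: measurableX.
  apply/(integrable_mkcond _ mD).
  apply: bounded_measurable_integrable => //.
  rewrite [X in (X < _)%E]product_measure1E//.
  by rewrite lte_mul_pinfty// ge0_fin_numE.
rewrite /Rintegral; congr fine.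
rewrite integral_mkcond -[LHS]/(\int[(m1 \x m2)%E]_z f z)%E.
rewrite -integral12_prod_meas1//.
rewrite [RHS]integral_mkcond; apply: eq_integral => x _.
rewrite /fubini_F patchE; case: ifPn => xD.
  rewrite fineK; last first.
    by apply: integrable_fin_num => //; exact: bounded_measurable_integrable.
  rewrite [RHS]integral_mkcond; apply: eq_integral => y _.
  by rewrite /f !patchE in_setX xD.
by rewrite integral0_eq// => y _; rewrite /f patchE in_setX (negbTE xD).
Qed.

End fubini.
End bounded_measurable.

Ltac bounded_measurable :=
  repeat first [ assumption | exact: bounded_measurable_cst
    | apply: bounded_measurableM | apply: bounded_measurableB
    | apply: bounded_measurableD | apply: bounded_measurableN ].

(** * Integration on the box *)

Section box_integral.
Context (R : realType) (L U : R).

Definition box_int n (F : n.-tuple R -> R) : R :=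
  \int[lebesgue_tuple R n]_(z in @box R L U n) F z.

Lemma measurable_box n : measurable (@box R L U n).
Proof.
rewrite (_ : box L U (n:=n) =
    \bigcap_(l in [set: 'I_n]) ((fun z => tnth z l) @^-1` `[L, U])).
  apply: fin_bigcap_measurable => // l _.
  by rewrite -[X in measurable X]setTI; exact: measurable_tnth.
apply/seteqP; split => z /=.
  by move=> Hz l _ /=; rewrite in_itv; exact: Hz.
by move=> Hz l; have := Hz l I; rewrite /= in_itv.
Qed.

Lemma preimage_box n :
  @tuple_cons R n @^-1` (@box R L U n.+1) = `[L, U] `*` @box R L U n.
Proof.
apply/seteqP; split => -[x z] /=.
  move=> H; split; first by have := H ord0; rewrite in_itv.
  by move=> l; have := H (lift ord0 l); rewrite tnthS.
move=> [+ H] l; rewrite in_itv /= => Hx.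
case: (unliftP ord0 l) => [j ->|->]; last by [].
by rewrite tnthS; exact: H.
Qed.

Let mLU : measurable (`[L, U]%classic : set R). Proof. exact: measurable_itv. Qed.

Let fLU : (lebesgue_measure (`[L, U]%classic : set R) < +oo)%E.
Proof. by rewrite lebesgue_measure_itv/=; case: ifP => _; rewrite ?ltry. Qed.

Lemma lebesgue_box_ltoo n : (lebesgue_tuple R n (@box R L U n) < +oo)%E.
Proof.
elim: n => [|n IH].
  by rewrite /= diracE; case: (_ \in _); rewrite ltry.
rewrite /= /lebesgue_cons /pushforward preimage_box product_measure1E//.
  by rewrite lte_mul_pinfty// ge0_fin_numE.
exact: measurable_box.
Qed.

Hint Resolve measurable_box lebesgue_box_ltoo mLU fLU : core.

Lemma box_int_integrable n (F : n.-tuple R -> R) : bounded_measurable F ->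
  (lebesgue_tuple R n).-integrable (@box R L U n) (EFin \o F).
Proof.
move=> bF; apply: bounded_measurable_integrable => //.
- exact: measurable_box.
- exact: lebesgue_box_ltoo.
Qed.

Hint Resolve box_int_integrable : core.

Lemma eq_box_int n (F G : n.-tuple R -> R) :
  (forall z, box L U z -> F z = G z) -> box_int F = box_int G.
Proof. by move=> FG; apply: eq_Rintegral => z /set_mem; exact: FG. Qed.

Lemma box_intD n (F G : n.-tuple R -> R) :
  bounded_measurable F -> bounded_measurable G ->
  box_int (fun z => F z + G z) = box_int F + box_int G.
Proof. by move=> bF bG; rewrite /box_int RintegralD//; do ?[exact: measurable_box|exact: box_int_integrable]. Qed.

Lemma box_intB n (F G : n.-tuple R -> R) :
  bounded_measurable F -> bounded_measurable G ->
  box_int (fun z => F z - G z) = box_int F - box_int G.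
Proof. by move=> bF bG; rewrite /box_int RintegralB//; do ?[exact: measurable_box|exact: box_int_integrable]. Qed.

Lemma box_intZ n (c : R) (F : n.-tuple R -> R) : bounded_measurable F ->
  box_int (fun z => c * F z) = c * box_int F.
Proof. by move=> bF; rewrite /box_int RintegralZl//; do ?[exact: measurable_box|exact: box_int_integrable]. Qed.

Lemma le_box_int n (F G : n.-tuple R -> R) :
  bounded_measurable F -> bounded_measurable G ->
  (forall z, box L U z -> F z <= G z) -> box_int F <= box_int G.
Proof. by move=> bF bG FG; apply: le_Rintegral => //; do ?[exact: measurable_box|exact: box_int_integrable]. Qed.

Lemma box_int_ge0 n (F : n.-tuple R -> R) :
  (forall z, box L U z -> 0 <= F z) -> 0 <= box_int F.
Proof. exact: Rintegral_ge0. Qed.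

Lemma box_int0 (F : 0.-tuple R -> R) : bounded_measurable F ->
  box_int F = F [tuple].
Proof.
move=> [mF _]; rewrite /box_int /Rintegral /= integral_dirac; last 2 first.
- exact: measurable_box.
- by apply/measurable_EFinP; exact: measurable_funTS.
by rewrite diracE mem_set ?mul1e// => -[].
Qed.

Lemma bounded_measurable_cons n (F : n.+1.-tuple R -> R) :
  bounded_measurable F -> bounded_measurable (fun p => F (tuple_cons p)).
Proof.
by move=> bF; apply: bounded_measurable_comp bF _; exact: measurable_tuple_cons.
Qed.

Lemma bounded_measurable_slice n (F : n.+1.-tuple R -> R) (x : R) :
  bounded_measurable F -> bounded_measurable (fun z => F (tuple_cons (x, z))).
Proof.
move=> /bounded_measurable_cons bF.
by apply: bounded_measurable_comp bF _; exact: pair1_measurable.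
Qed.

Lemma bounded_measurable_box_int d (T : measurableType d) n
    (F : T * n.-tuple R -> R) : bounded_measurable F ->
  bounded_measurable (fun x => box_int (fun z => F (x, z))).
Proof.
by move=> bF; apply: bounded_measurable_Rintegral => //;
  do ?[exact: measurable_box|exact: lebesgue_box_ltoo].
Qed.

Lemma bounded_measurable_itv_int d (T : measurableType d) (F : T * R -> R) :
  bounded_measurable F ->
  bounded_measurable (fun x => \int[lebesgue_measure]_(t in `[L, U]) F (x, t)).
Proof.
by move=> bF; apply: bounded_measurable_Rintegral => //;
  do ?[exact: measurable_box|exact: lebesgue_box_ltoo].
Qed.

(** [lebesgue_tuple] in dimension [n.+1] is by construction the image of a product measure under
    [tuple_cons], along which the box pulls back to a product. This is the recursion behind every
    induction on the dimension. *)
Lemma box_intS n (F : n.+1.-tuple R -> R) : bounded_measurable F ->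
  box_int F = \int[lebesgue_measure]_(x in `[L, U])
    box_int (fun z => F (tuple_cons (x, z))).
Proof.
move=> bF; have bFc := bounded_measurable_cons bF.
rewrite -(@Rintegral_product R _ _ _ _ lebesgue_measure (lebesgue_tuple R n) _ _ mLU (@measurable_box n) fLU (@lebesgue_box_ltoo n) _ bFc).
rewrite -preimage_box.
rewrite /box_int /Rintegral; congr fine.
pose m12 := (@lebesgue_measure R \x lebesgue_tuple R n)%E.
have mF : measurable_fun setT (EFin \o F) by apply/measurable_EFinP; case: bF.
have intF : m12.-integrable (@tuple_cons R n @^-1` @box R L U n.+1)
    ((EFin \o F) \o @tuple_cons R n).
  apply: (@bounded_measurable_integrable _ _ _ m12 _
    (fun p => F (tuple_cons p))) => //; rewrite preimage_box.
    by apply: measurableX => //; exact: measurable_box.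
  rewrite [X in (X < _)%E]product_measure1E//; last exact: measurable_box.
  by rewrite lte_mul_pinfty// ?ge0_fin_numE//; exact: lebesgue_box_ltoo.
rewrite -[RHS](integral_pushforward _ mF intF (@measurable_box n.+1)); last exact: measurable_tuple_cons.
apply: eq_measure_integral; first exact: measurable_tuple_cons.
by move=> mt A mA _.
Qed.

Lemma box_int_fubini n (F : R * n.-tuple R -> R) : bounded_measurable F ->
  \int[lebesgue_measure]_(x in `[L, U]) box_int (fun z => F (x, z)) =
  box_int (fun z => \int[lebesgue_measure]_(x in `[L, U]) F (x, z)).
Proof. 
move=> bF; apply: (@Rintegral_fubini R _ _ _ _ lebesgue_measure (lebesgue_tuple R n) _ _ _ _ _ _ _ bF) => //.
  exact: measurable_box.
exact: lebesgue_box_ltoo.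
 Qed.

End box_integral.

(** * The FKG inequality *)

Section four_functions.
Context (R : realType) (L U : R).

Definition itv_int (f : R -> R) : R := \int[lebesgue_measure]_(x in `[L, U]) f x.

Lemma itv_int_integrable (f : R -> R) : bounded_measurable f ->
  lebesgue_measure.-integrable `[L, U] (EFin \o f).
Proof.
move=> bf; apply: bounded_measurable_integrable => //.
by rewrite /= lebesgue_measure_itv/=; case: ifP => _; rewrite ?ltry.
Qed.

Lemma itv_intD (f g : R -> R) : bounded_measurable f -> bounded_measurable g ->
  itv_int (fun x => f x + g x) = itv_int f + itv_int g.
Proof. by move=> bf bg; rewrite /itv_int RintegralD//; exact: itv_int_integrable. Qed.

Lemma itv_intB (f g : R -> R) : bounded_measurable f -> bounded_measurable g ->
  itv_int (fun x => f x - g x) = itv_int f - itv_int g.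
Proof. by move=> bf bg; rewrite /itv_int RintegralB//; exact: itv_int_integrable. Qed.

Lemma itv_intZ (c : R) (f : R -> R) : bounded_measurable f ->
  itv_int (fun x => c * f x) = c * itv_int f.
Proof. by move=> bf; rewrite /itv_int RintegralZl//; exact: itv_int_integrable. Qed.

Lemma le_itv_int (f g : R -> R) : bounded_measurable f -> bounded_measurable g ->
  (forall x, L <= x <= U -> f x <= g x) -> itv_int f <= itv_int g.
Proof.
by move=> bf bg fg; apply: le_Rintegral => //; exact: itv_int_integrable.
Qed.

(** One-dimensional Ahlswede-Daykin inequality. Twice a product of two integrals is the double
    integral of an integrand symmetrised in [x] and [y], so the pointwise inequality [twopoint]
    suffices. *)
Lemma four_functions_itv (g1 g2 g3 g4 : R -> R) :
  bounded_measurable g1 -> bounded_measurable g2 ->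
  bounded_measurable g3 -> bounded_measurable g4 ->
  (forall x, [/\ 0 <= g1 x, 0 <= g2 x, 0 <= g3 x & 0 <= g4 x]) ->
  (forall x y, g1 x * g2 y <= g3 (Num.max x y) * g4 (Num.min x y)) ->
  itv_int g1 * itv_int g2 <= itv_int g3 * itv_int g4.
Proof.
move=> b1 b2 b3 b4 g0 g1234.
have twopoint x y :
    g1 x * g2 y + g2 x * g1 y <= g3 x * g4 y + g4 x * g3 y.
  wlog xy : x y / x <= y => [wlg|].
    have [xy|/ltW yx] := leP x y; first exact: wlg.
    by have := wlg _ _ yx; lra.
  have := g1234 x y; have := g1234 y x.
  have := g1234 x x; have := g1234 y y.
  rewrite !maxxx !minxx (max_r xy) (min_l xy) (max_l xy) (min_r xy).
  have [] := g0 x; have [] := g0 y.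
  set a1 := g1 x; set a2 := g2 x; set a3 := g3 x; set a4 := g4 x.
  set c1 := g1 y; set c2 := g2 y; set c3 := g3 y; set c4 := g4 y.
  move=> hc1 hc2 hc3 hc4 ha1 ha2 ha3 ha4 hyy hxx hyx hxy.
  set A := a1 * c2 in hxy *; set B := c1 * a2 in hyx.
  set C := c3 * a4 in hxy hyx.
  rewrite (mulrC a2) -/B (mulrC a4) -/C; set E := a3 * c4.
  have A0 : 0 <= A by exact: mulr_ge0.
  have B0 : 0 <= B by exact: mulr_ge0.
  have E0 : 0 <= E by exact: mulr_ge0.
  have ABCE : A * B <= C * E.
    have := ler_pM (mulr_ge0 ha1 ha2) (mulr_ge0 hc1 hc2) hxx hyy.
    by rewrite /A /B /C /E; nra.
  (* From [A, B <= C] and [A * B <= C * E] follows [C * (C + E - A - B) >= (C - A) * (C - B) >= 0];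
     if [C] vanishes, so do [A] and [B]. *)
  have [C0|C0] := leP C 0; first by lra.
  rewrite -(ler_pM2l C0).
  have : 0 <= (C - A) * (C - B) by apply: mulr_ge0; lra.
  nra.
have inner (g h : R -> R) (gb : bounded_measurable g)
    (hb : bounded_measurable h) :
  itv_int (fun x => itv_int (fun y => g x * h y + h x * g y))
    = 2 * (itv_int g * itv_int h).
  transitivity (itv_int (fun x => itv_int h * g x + itv_int g * h x)).
    congr itv_int; apply/funext => x.
    rewrite itv_intD ?itv_intZ//; first by ring.
      exact: bounded_measurableZ.
    exact: bounded_measurableZ.
  rewrite itv_intD ?itv_intZ//; first by ring.
    exact: bounded_measurableZ.
  exact: bounded_measurableZ.
have binner (g h : R -> R) (gb : bounded_measurable g)
    (hb : bounded_measurable h) :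
    bounded_measurable (fun x => itv_int (fun y => g x * h y + h x * g y)).
  rewrite (_ : (fun _ => _) = fun x => itv_int h * g x + itv_int g * h x).
    by apply: bounded_measurableD; exact: bounded_measurableZ.
  apply/funext => x; rewrite itv_intD ?itv_intZ//; first by ring.
    exact: bounded_measurableZ.
  exact: bounded_measurableZ.
rewrite -(ler_pM2l (ltr0n _ 2)) -!inner//.
apply: le_itv_int; [exact: binner|exact: binner|move=> x _].
apply: le_itv_int => [||y _]; last exact: twopoint.
  by apply: bounded_measurableD; exact: bounded_measurableZ.
by apply: bounded_measurableD; exact: bounded_measurableZ.
Qed.

(** A relation rather than two lattice operations: after slicing or updating a tuple, meet and join
    only have to be recognised coordinate by coordinate. *)
Definition is_meet_join n (s t u w : n.-tuple R) :=
  forall l, tnth u l = Num.min (tnth s l) (tnth t l) /\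
            tnth w l = Num.max (tnth s l) (tnth t l).

(** With first coordinates [x] and [y] fixed, the induction hypothesis says that the four marginals
    in the first coordinate satisfy the hypothesis of the one-dimensional case. *)
Lemma four_functions n (f1 f2 f3 f4 : n.-tuple R -> R) :
  bounded_measurable f1 -> bounded_measurable f2 ->
  bounded_measurable f3 -> bounded_measurable f4 ->
  (forall z, [/\ 0 <= f1 z, 0 <= f2 z, 0 <= f3 z & 0 <= f4 z]) ->
  (forall s t u w, is_meet_join s t u w -> f1 s * f2 t <= f3 w * f4 u) ->
  box_int L U f1 * box_int L U f2 <= box_int L U f3 * box_int L U f4.
Proof.
elim: n => [|n IH] in f1 f2 f3 f4 * => b1 b2 b3 b4 f0 f1234.
  by rewrite !box_int0//; apply: f1234 => -[].
have bI (f : n.+1.-tuple R -> R) (bf : bounded_measurable f) :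
    bounded_measurable (fun x => box_int L U (fun z => f (tuple_cons (x, z)))).
  exact: (bounded_measurable_box_int L U (bounded_measurable_cons bf)).
rewrite !box_intS//; apply: four_functions_itv; do ?exact: bI.
  by move=> x; split; apply: box_int_ge0 => z _; have [] := f0 (tuple_cons (x, z)).
move=> x y; apply: IH; do ?exact: bounded_measurable_slice.
  by move=> z; split; [have [] := f0 (tuple_cons (x, z))|
    have [] := f0 (tuple_cons (y, z))|
    have [] := f0 (tuple_cons (Num.max x y, z))|
    have [] := f0 (tuple_cons (Num.min x y, z))].
move=> s t u w stuw; apply: f1234 => l.
case: (unliftP ord0 l) => [j ->|->]; last by [].
by rewrite !tnthS; exact: stuw.
Qed.

End four_functions.

Section weighted_covariance.
Context (R : realType) (L U : R) (n : nat) (W : n.-tuple R -> R).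
Hypothesis bW : bounded_measurable W.
Local Notation I := (box_int L U).

(** The covariance under the probability density [W / I W], multiplied by [(I W) ^+ 2]; this form
    needs no division by the partition function. *)
Definition wcov (F G : n.-tuple R -> R) : R :=
  I W * I (fun z => F z * G z * W z)
  - I (fun z => F z * W z) * I (fun z => G z * W z).

Lemma wcovC F G : wcov F G = wcov G F.
Proof.
rewrite /wcov [X in _ - X]mulrC; congr (_ * _ - _).
by apply: eq_box_int => z _; rewrite (mulrC (F z)).
Qed.

Lemma eq_wcov F F' G G' : (forall z, box L U z -> F z = F' z) ->
  (forall z, box L U z -> G z = G' z) -> wcov F G = wcov F' G'.
Proof.
move=> FF GG; congr (_ * _ - _ * _);
  by apply: eq_box_int => z Hz; rewrite ?FF ?GG.
Qed.

Lemma wcovD F G H : bounded_measurable F -> bounded_measurable G ->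
  bounded_measurable H ->
  wcov F (fun z => G z + H z) = wcov F G + wcov F H.
Proof.
move=> bF bG bH; rewrite /wcov.
have -> : I (fun z => F z * (G z + H z) * W z)
    = I (fun z => F z * G z * W z) + I (fun z => F z * H z * W z).
  rewrite -box_intD; [|bounded_measurable..].
  by apply: eq_box_int => z _; ring.
have -> : I (fun z => (G z + H z) * W z)
    = I (fun z => G z * W z) + I (fun z => H z * W z).
  rewrite -box_intD; [|bounded_measurable..].
  by apply: eq_box_int => z _; ring.
ring.
Qed.

Lemma wcovZ (c : R) F G : bounded_measurable F -> bounded_measurable G ->
  wcov F (fun z => c * G z) = c * wcov F G.
Proof.
move=> bF bG; rewrite /wcov.
have -> : I (fun z => F z * (c * G z) * W z) = c * I (fun z => F z * G z * W z).
  rewrite -box_intZ; [|bounded_measurable].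
  by apply: eq_box_int => z _; ring.
have -> : I (fun z => (c * G z) * W z) = c * I (fun z => G z * W z).
  rewrite -box_intZ; [|bounded_measurable].
  by apply: eq_box_int => z _; ring.
ring.
Qed.

Lemma wcov_cst F (c : R) : bounded_measurable F -> wcov F (fun=> c) = 0.
Proof.
move=> bF; rewrite /wcov.
have -> : I (fun z => F z * c * W z) = c * I (fun z => F z * W z).
  rewrite -box_intZ; [|bounded_measurable].
  by apply: eq_box_int => z _; ring.
by rewrite box_intZ//; ring.
Qed.

Lemma wcovB F G H : bounded_measurable F -> bounded_measurable G ->
  bounded_measurable H ->
  wcov F (fun z => G z - H z) = wcov F G - wcov F H.
Proof.
move=> bF bG bH.
rewrite (_ : (fun z => _) = fun z => G z + (-1) * H z); last first.
  by apply/funext => z; ring.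
rewrite wcovD ?wcovZ//; first by ring.
exact: bounded_measurableZ.
Qed.

Lemma wcov_sum F (J : Type) (r : seq J) (P : pred J) (G : J -> n.-tuple R -> R) :
  bounded_measurable F -> (forall j, P j -> bounded_measurable (G j)) ->
  wcov F (fun z => \sum_(j <- r | P j) G j z) = \sum_(j <- r | P j) wcov F (G j).
Proof.
move=> bF bG; elim: r => [|j r IH].
  rewrite big_nil -[RHS](wcov_cst 0 bF); congr wcov; apply/funext => z.
  by rewrite big_nil.
rewrite big_cons -IH; have [Pj|nPj] := boolP (P j).
  rewrite -wcovD//; [|exact: bG|exact: bounded_measurable_sum].
  by congr wcov; apply/funext => z; rewrite big_cons Pj.
by congr wcov; apply/funext => z; rewrite big_cons (negbTE nPj).
Qed.

Definition coord_nondecreasing (F : n.-tuple R -> R) :=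
  forall s t : n.-tuple R, (forall l, tnth s l <= tnth t l) -> F s <= F t.

Hypothesis W_ge0 : forall z, 0 <= W z.
Hypothesis W_lsm : forall s t u w, is_meet_join s t u w -> W s * W t <= W w * W u.

(** The four functions are [F W], [G W], [F G W] and [W]: at the join [F] and [G] only grow, and the
    weights are compared by log-supermodularity. *)
Lemma fkg_ge0 F G : bounded_measurable F -> bounded_measurable G ->
  (forall z, 0 <= F z) -> (forall z, 0 <= G z) ->
  coord_nondecreasing F -> coord_nondecreasing G -> 0 <= wcov F G.
Proof.
move=> bF bG F0 G0 mF mG; rewrite subr_ge0 [leRHS]mulrC.
have bFW := bounded_measurableM bF bW; have bGW := bounded_measurableM bG bW.
apply: four_functions => //.
- by apply: bounded_measurableM => //; exact: bounded_measurableM.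
- by move=> z; split => //; rewrite ?mulr_ge0// mulr_ge0.
move=> s t u w stuw.
rewrite mulrACA [leRHS](_ : _ = F w * G w * (W w * W u)); last by ring.
apply: ler_pM; rewrite ?mulr_ge0//; last exact: W_lsm.
by apply: ler_pM => //; [apply: mF|apply: mG] => l; have [_ ->] := stuw l;
  rewrite le_max lexx ?orbT.
Qed.

(** A covariance ignores additive constants, so adding the bounds [M] and [N] reduces to nonnegative
    functions. *)
Lemma fkg F G : bounded_measurable F -> bounded_measurable G ->
  coord_nondecreasing F -> coord_nondecreasing G -> 0 <= wcov F G.
Proof.
move=> bF bG mF mG; have [_ [M HM]] := bF; have [_ [N HN]] := bG.
have bM := bounded_measurable_cst (n.-tuple R) M.
have bN := bounded_measurable_cst (n.-tuple R) N.
have bFM := bounded_measurableD bF bM; have bGN := bounded_measurableD bG bN.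
have -> : wcov F G = wcov (fun z => F z + M) (fun z => G z + N).
  rewrite [RHS]wcovD// wcov_cst// addr0 [RHS]wcovC wcovD// wcov_cst// addr0.
  exact: wcovC.
apply: fkg_ge0 => //.
- by move=> z; have := HM z; rewrite ler_norml -[leRHS]addr0 => /andP[]; lra.
- by move=> z; have := HN z; rewrite ler_norml -[leRHS]addr0 => /andP[]; lra.
- by move=> s t st; rewrite lerD2r; exact: mF.
- by move=> s t st; rewrite lerD2r; exact: mG.
Qed.

End weighted_covariance.

(** * Integration by parts in one coordinate *)

Section coordinate_update.
Context (R : realType).

Definition upd n (a : 'I_n) (t : R) (z : n.-tuple R) : n.-tuple R :=
  [tuple if l == a then t else tnth z l | l < n].

Lemma tnth_upd n (a : 'I_n) t z l :
  tnth (upd a t z) l = if l == a then t else tnth z l.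
Proof. by rewrite tnth_mktuple. Qed.

Lemma upd_upd n (a : 'I_n) s t z : upd a s (upd a t z) = upd a s z.
Proof. by apply: eq_from_tnth => l; rewrite !tnth_upd; case: eqP. Qed.

Lemma upd_head n t x (z : n.-tuple R) :
  upd ord0 t (tuple_cons (x, z)) = tuple_cons (t, z).
Proof.
apply: eq_from_tnth => l; rewrite tnth_upd.
case: (unliftP ord0 l) => [j ->|->]; last by rewrite eqxx.
by rewrite !tnthS eq_sym (negbTE (neq_lift _ _)).
Qed.

Lemma upd_behead n (a : 'I_n) t x (z : n.-tuple R) :
  upd (lift ord0 a) t (tuple_cons (x, z)) = tuple_cons (x, upd a t z).
Proof.
apply: eq_from_tnth => l; rewrite tnth_upd.
case: (unliftP ord0 l) => [j ->|->]; last by [].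
by rewrite !tnthS tnth_upd (inj_eq (@lift_inj _ ord0)).
Qed.

Lemma measurable_upd n (a : 'I_n) :
  measurable_fun [set: n.-tuple R * R] (fun p => upd a p.2 p.1).
Proof.
apply/measurable_fun_tnthP => l /=.
have [->|la] := eqVneq l a.
  rewrite (_ : _ \o _ = snd)//; apply/funext => p /=.
  by rewrite tnth_upd eqxx.
rewrite (_ : _ \o _ = (fun z => tnth z l) \o fst).
  by apply: measurableT_comp => //; exact: measurable_tnth.
by apply/funext => p /=; rewrite tnth_upd (negbTE la).
Qed.

Lemma bounded_measurable_upd n (a : 'I_n) (F : n.-tuple R -> R) :
  bounded_measurable F ->
  bounded_measurable (fun p : n.-tuple R * R => F (upd a p.2 p.1)).
Proof. by move=> bF; apply: bounded_measurable_comp bF _; exact: measurable_upd. Qed.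

Lemma bounded_measurable_upd1 n (a : 'I_n) t (F : n.-tuple R -> R) :
  bounded_measurable F -> bounded_measurable (fun z => F (upd a t z)).
Proof.
move=> /(bounded_measurable_upd a) bF.
exact: (bounded_measurable_comp bF (pair2_measurable t)).
Qed.

Lemma bounded_measurable_upd2 n (a : 'I_n) z (F : n.-tuple R -> R) :
  bounded_measurable F -> bounded_measurable (fun t => F (upd a t z)).
Proof.
move=> /(bounded_measurable_upd a) bF.
exact: (bounded_measurable_comp bF (pair1_measurable z)).
Qed.

Context (L U : R) (LU : L < U).

Lemma bounded_measurable_upd_int n (a : 'I_n) (F : n.-tuple R -> R) :
  bounded_measurable F ->
  bounded_measurable (fun z => itv_int L U (fun t => F (upd a t z))).
Proof.
move=> /(bounded_measurable_upd a) bF.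
exact: (bounded_measurable_itv_int L U bF).
Qed.

Lemma itv_int_cst (c : R) : itv_int L U (fun=> c) = (U - L) * c.
Proof.
rewrite /itv_int Rintegral_cst// mulrC /= lebesgue_measure_itv/= lte_fin LU.
by rewrite -EFinD.
Qed.

(** Fubini in the coordinate [a] without permuting coordinates: the inner integral no longer depends
    on the old value of that coordinate, whose integration produces the factor [U - L]. *)
Lemma box_int_upd n (a : 'I_n) (F : n.-tuple R -> R) : bounded_measurable F ->
  (U - L) * box_int L U F = box_int L U (fun z => itv_int L U (fun t => F (upd a t z))).
Proof.
elim: n => [|n IH] in a F *; first by case: a.
move=> bF; rewrite [in RHS]box_intS; last exact: bounded_measurable_upd_int.
case: (unliftP ord0 a) => [b ->|->].
  rewrite box_intS// -itv_intZ; last first.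
    exact: (bounded_measurable_box_int L U (bounded_measurable_cons bF)).
  congr itv_int; apply/funext => x.
  rewrite (IH b); last exact: bounded_measurable_slice.
  by congr box_int; apply/funext => z; congr itv_int; apply/funext => t;
    rewrite upd_behead.
rewrite -[RHS]/(itv_int L U _).
transitivity (itv_int L U (fun=> box_int L U F)); first by rewrite itv_int_cst.
congr itv_int; apply/funext => x.
rewrite box_intS// (box_int_fubini L U (bounded_measurable_cons bF)).
by congr box_int; apply/funext => z; congr itv_int; apply/funext => t;
  rewrite upd_head.
Qed.

End coordinate_update.

Section by_parts.
Context (R : realType) (L U : R) (LU : L < U).
Context (n : nat) (W : n.-tuple R -> R) (a : 'I_n) (D : n.-tuple R -> R).
Hypotheses (bW : bounded_measurable W) (bD : bounded_measurable D).
Variable w0 : R.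
Hypotheses (w0_gt0 : 0 < w0) (W_ge : forall z, w0 <= W z).
Hypothesis W_lsm : forall s t u w, is_meet_join s t u w -> W s * W t <= W w * W u.
(* [D] is minus the logarithmic derivative of [W] in the coordinate [a]; the
   function [k] is needed because [W] need not be smooth outside the box. *)
Hypothesis W_derive : forall z, exists k : R -> R,
  [/\ forall t, L <= t <= U -> W (upd a t z) = k t,
      {within `[L, U], continuous (fun t => D (upd a t z))}
    & forall t, L <= t <= U -> is_derive t 1 k (- (D (upd a t z) * k t))].

Local Notation I := (box_int L U).
Local Notation J := (itv_int L U).

Let W_ge0 z : 0 <= W z. Proof. exact: le_trans (ltW w0_gt0) (W_ge z). Qed.

(** Along the coordinate [a], [D * W] is the derivative of [- W]. The boundary terms remain, because
    [W] does not vanish at the ends of the interval. *)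
Lemma itv_int_by_parts (f F : R -> R) z :
  {within `[L, U], continuous f} ->
  derivable_oo_LRcontinuous F L U ->
  {in `]L, U[, derive1 F =1 f} ->
  J (fun t => F t * (D (upd a t z) * W (upd a t z))) =
  J (fun t => f t * W (upd a t z))
    - (F U * W (upd a U z) - F L * W (upd a L z)).
Proof.
move=> cf dF Ff; have [k [Wk cD dk]] := W_derive z.
have LUE t : t \in `[L, U]%classic -> L <= t <= U.
  by rewrite inE /= in_itv.
have LUo t : t \in `]L, U[ -> L <= t <= U.
  by rewrite in_itv /= => /andP[/ltW -> /ltW ->].
have LL : L <= L <= U by rewrite lexx ltW.
have LLU : L <= U <= U by rewrite lexx ltW.
have ck t : L <= t <= U -> {for t, continuous k}.
  by move=> /dk [? _]; apply/differentiable_continuous/derivable1_diffP.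
have wk : {within `[L, U], continuous k}.
  apply: continuous_in_subspaceT => t tI; exact/ck/LUE.
have dkLR : derivable_oo_LRcontinuous k L U.
  split.
  - by move=> t /LUo /dk [].
  - by apply/cvg_at_right_filter; exact: ck.
  - by apply/cvg_at_left_filter; exact: ck.
rewrite /itv_int (@eq_Rintegral _ _ _ lebesgue_measure _ (fun t => -1 * (F t * (- (D (upd a t z) * k t)))));
  last first.
  by move=> t /LUE tI; rewrite Wk//; ring.
have cg : {within `[L, U], continuous (fun t => - (D (upd a t z) * k t))}.
  move=> t; apply: cvgN; apply: cvgM; [exact: cD|exact: wk].
rewrite RintegralZl//; last first.
  apply: continuous_compact_integrable; first exact: segment_compact.
  move=> t; apply: cvgM; last exact: cg.
  exact: (derivable_oo_LRcontinuous_within dF).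
rewrite (@Rintegration_by_parts _ F k f)//; last first.
  by move=> t /LUo tI; rewrite derive1E; have [_ ->] := dk _ tI.
rewrite (Wk U)// (Wk L)//.
rewrite (@eq_Rintegral _ _ _ lebesgue_measure _ (fun t => f t * k t) (fun t => f t * W (upd a t z))).
  by ring.
by move=> t /LUE tI; rewrite Wk.
Qed.

Let int_ge z : w0 * (U - L) <= J (fun t => W (upd a t z)).
Proof.
rewrite mulrC -itv_int_cst//; apply: le_itv_int => //.
  exact: bounded_measurable_cst.
exact: bounded_measurable_upd2.
Qed.

Let int_gt0 z : 0 < J (fun t => W (upd a t z)).
Proof. by apply: lt_le_trans (int_ge z); rewrite mulr_gt0// subr_gt0. Qed.

(** The density at [t] of the conditional law of the coordinate [a] given the others; it does not
    depend on the coordinate [a] of [z]. *)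
Definition cond_density (t : R) (z : n.-tuple R) : R :=
  W (upd a t z) / J (fun x => W (upd a x z)).

Lemma bounded_measurable_cond_density t : bounded_measurable (cond_density t).
Proof.
apply: bounded_measurableM; first exact: bounded_measurable_upd1.
have c0 : 0 < w0 * (U - L) by rewrite mulr_gt0// subr_gt0.
(* The normalisation is at least [w0 * (U - L)], so the maximum changes nothing; it makes the
   inverse monotone and bounded on the whole line. *)
rewrite (_ : (fun _ => _) = (fun x => (Num.max (w0 * (U - L)) x)^-1) \o
    (fun z => J (fun x => W (upd a x z)))); last first.
  by apply/funext => z /=; rewrite max_r.
have [mJ _] := bounded_measurable_upd_int L U a bW; split.
  apply: measurableT_comp => //; apply: nonincreasing_measurable => //.
  move=> x y yx; rewrite lef_pV2 ?posrE ?lt_max ?c0//.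
  by rewrite ge_max !le_max lexx yx orbT.
exists (w0 * (U - L))^-1 => z /=; rewrite ger0_norm ?invr_ge0 ?le_max ?(ltW c0)//.
by rewrite lef_pV2 ?posrE ?lt_max ?c0// le_max lexx.
Qed.

Let le_density (x y : R) s t :
  (forall u, L <= u <= U -> W (upd a x s) * W (upd a u t) <=
    W (upd a y t) * W (upd a u s)) ->
  W (upd a x s) / J (fun u => W (upd a u s)) <=
  W (upd a y t) / J (fun u => W (upd a u t)).
Proof.
move=> H; rewrite ler_pdivrMr// mulrAC ler_pdivlMr//.
rewrite -!itv_intZ; do ?exact: bounded_measurable_upd2.
by apply: le_itv_int => //; apply: bounded_measurableZ; exact: bounded_measurable_upd2.
Qed.

(** Log-supermodularity is a monotone likelihood ratio: raising the other coordinates pushes the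
    conditional law to the right, so its density grows at [U] and, in the next lemma, drops at [L].
    After cross-multiplication, [upd a U t] and [upd a u s] are a join and a meet. *)
Lemma cond_density_right_nondecreasing : coord_nondecreasing (cond_density U).
Proof.
move=> s t st; apply: le_density => u /andP[Lu uU].
apply: W_lsm => l; rewrite !tnth_upd; case: eqP => _.
  by rewrite (min_r uU) (max_l uU).
by rewrite (min_l (st l)) (max_r (st l)).
Qed.

Lemma cond_density_left_nonincreasing :
  coord_nondecreasing (fun z => - cond_density L z).
Proof.
move=> s t st; rewrite lerN2; apply: le_density => u /andP[Lu uU].
rewrite [leRHS]mulrC.
apply: W_lsm => l; rewrite !tnth_upd; case: eqP => _.
  by rewrite (min_l Lu) (max_r Lu).
by rewrite (min_r (st l)) (max_l (st l)).
Qed.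

(** Rewrites an integral over the face where the coordinate [a] equals [t] as an integral against
    [W] itself, so that boundary terms become covariances accessible to FKG. *)
Lemma box_int_cond_density t (F : n.-tuple R -> R) : bounded_measurable F ->
  (forall x z, F (upd a x z) = F z) ->
  (U - L) * I (fun z => F z * cond_density t z * W z) =
  I (fun z => F z * W (upd a t z)).
Proof.
move=> bF Fa; have bd := bounded_measurable_cond_density t.
rewrite (box_int_upd LU a); last by bounded_measurable.
congr box_int; apply/funext => z.
transitivity (J (fun x => F z * cond_density t z * W (upd a x z))).
  congr itv_int; apply/funext => x; rewrite Fa; congr (_ * _ * _).
  rewrite /cond_density upd_upd; congr (_ / _); congr itv_int.
  by apply/funext => y; rewrite upd_upd.
rewrite itv_intZ; last exact: bounded_measurable_upd2.
by rewrite /cond_density -mulrA -[in X in _ * X]mulrA mulVf ?mulr1// gt_eqF.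
Qed.

Let derivable_cst : derivable_oo_LRcontinuous (fun=> 1 : R) L U.
Proof. by split; [move=> x _; exact: derivable_cst|exact: cvg_cst|exact: cvg_cst]. Qed.

Let itv_int_by_parts1 z : J (fun t => D (upd a t z) * W (upd a t z)) =
  W (upd a L z) - W (upd a U z).
Proof.
have := @itv_int_by_parts (fun=> 0) (fun=> 1) z _ derivable_cst.
under [X in J X = _]eq_fun do rewrite mul1r.
move=> ->; last 2 first.
- by apply: continuous_subspaceT => x; exact: cst_continuous.
- by move=> x _; rewrite derive1_cst.
under [X in J X]eq_fun do rewrite mul0r.
by rewrite itv_int_cst//; ring.
Qed.

(** As [F] is constant in the coordinate [a], integration by parts leaves only boundary terms:
    against such functions [D] acts as [- r], where [r] is the conditional density at [U] minus the
    one at [L]. This [r] is nondecreasing, so FKG gives the sign. *)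
Lemma wcov_log_derive_le0 (F : n.-tuple R -> R) : bounded_measurable F ->
  (forall x z, F (upd a x z) = F z) -> coord_nondecreasing F ->
  wcov L U W F D <= 0.
Proof.
move=> bF Fa mF.
pose r z := - cond_density L z + cond_density U z.
have bdL := bounded_measurable_cond_density L.
have bdU := bounded_measurable_cond_density U.
have br : bounded_measurable r.
  by apply: bounded_measurableD => //; exact: bounded_measurableN.
have IDW G : bounded_measurable G -> (forall x z, G (upd a x z) = G z) ->
    I (fun z => G z * D z * W z) = - I (fun z => G z * r z * W z).
  move=> bG Ga; apply: (@mulfI _ (U - L)); first by rewrite gt_eqF// subr_gt0.
  have bGL := bounded_measurable_upd1 a L bW.
  have bGU := bounded_measurable_upd1 a U bW.
  transitivity (I (fun z => G z * W (upd a L z)) - I (fun z => G z * W (upd a U z))).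
    rewrite (box_int_upd LU a); last by bounded_measurable.
    rewrite -box_intB; [|bounded_measurable..].
    congr box_int; apply/funext => z.
    transitivity (J (fun x => G z * (D (upd a x z) * W (upd a x z)))).
      by congr itv_int; apply/funext => x; rewrite Ga mulrA.
    rewrite itv_intZ ?itv_int_by_parts1; first by ring.
    by apply: bounded_measurableM; exact: bounded_measurable_upd2.
  rewrite -!box_int_cond_density// -mulrBr -box_intB; [|bounded_measurable..].
  rewrite mulrN -mulrN; congr (_ * _); rewrite -mulN1r -box_intZ.
    by congr box_int; apply/funext => z; rewrite /r; ring.
  by bounded_measurable.
have -> : wcov L U W F D = - wcov L U W F r.
  rewrite /wcov IDW//.
  have := IDW (fun=> 1) (bounded_measurable_cst _ 1) (fun _ _ => erefl).
  under [X in I X = _]eq_fun do rewrite mul1r.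
  under [X in _ = - I X]eq_fun do rewrite mul1r.
  by move=> ->; ring.
rewrite oppr_le0; apply: fkg => // s t st; rewrite /r lerD//.
  exact: cond_density_left_nonincreasing.
exact: cond_density_right_nondecreasing.
Qed.

Lemma wcov_log_derive_coord (P f c : R -> R) :
  (forall x, L <= c x <= U) -> (forall x, L <= x <= U -> c x = x) ->
  bounded_measurable (fun z : n.-tuple R => P (c (tnth z a))) ->
  bounded_measurable (fun z : n.-tuple R => f (c (tnth z a))) ->
  {within `[L, U], continuous f} ->
  derivable_oo_LRcontinuous P L U -> {in `]L, U[, derive1 P =1 f} ->
  (forall x, L <= x <= U -> P L <= P x <= P U) ->
  wcov L U W (fun z => P (c (tnth z a))) D <= I W * I (fun z => f (c (tnth z a)) * W z).
Proof.
move=> cLU cE bP bf cf dP Pf PLU.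
have bL := bounded_measurable_upd1 a L bW.
have bU := bounded_measurable_upd1 a U bW.
have LU0 : 0 < U - L by rewrite subr_gt0.
have EP : (U - L) * I (fun z => P (c (tnth z a)) * D z * W z) =
    (U - L) * I (fun z => f (c (tnth z a)) * W z)
    - (P U * I (fun z => W (upd a U z)) - P L * I (fun z => W (upd a L z))).
  rewrite !(box_int_upd LU a); [|bounded_measurable..].
  have bfW : bounded_measurable (fun z => f (c (tnth z a)) * W z).
    exact: bounded_measurableM.
  have bJ := bounded_measurable_upd_int L U a bfW.
  rewrite -!box_intZ; [|bounded_measurable..].
  rewrite -!box_intB; [|bounded_measurable; exact: bounded_measurableZ..].
  congr box_int; apply/funext => z.
  transitivity (J (fun t => P t * (D (upd a t z) * W (upd a t z)))).
    apply: eq_Rintegral => t; rewrite inE /= in_itv /= => tI.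
    by rewrite tnth_upd eqxx cE// mulrA.
  rewrite (itv_int_by_parts _ cf dP Pf); congr (_ - _).
  apply: eq_Rintegral => t; rewrite inE /= in_itv /= => tI.
  by rewrite tnth_upd eqxx cE.
have E1 : (U - L) * I (fun z => D z * W z) =
    I (fun z => W (upd a L z)) - I (fun z => W (upd a U z)).
  rewrite (box_int_upd LU a); last by bounded_measurable.
  rewrite -box_intB//; congr box_int; apply/funext => z.
  exact: itv_int_by_parts1.
rewrite -(ler_pM2l LU0) /wcov.
have IPW_le : I (fun z => P (c (tnth z a)) * W z) <= P U * I W.
  rewrite -box_intZ//; apply: le_box_int; [bounded_measurable..|move=> z _].
  by rewrite ler_wpM2r//; have /andP[] := PLU _ (cLU (tnth z a)).
have IPW_ge : P L * I W <= I (fun z => P (c (tnth z a)) * W z).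
  rewrite -box_intZ//; apply: le_box_int; [bounded_measurable..|move=> z _].
  by rewrite ler_wpM2r//; have /andP[] := PLU _ (cLU (tnth z a)).
have IL0 : 0 <= I (fun z => W (upd a L z)) by exact: box_int_ge0.
have IU0 : 0 <= I (fun z => W (upd a U z)) by exact: box_int_ge0.
rewrite mulrBr mulrCA EP [X in _ - X]mulrCA E1.
(* All boundary terms together equal minus the sum of the two products shown nonnegative in [h1] and
   [h2]: each face integral times the gap between the extreme value of [P] there and its weighted
   mean. *)
have := mulr_ge0 IL0; have := mulr_ge0 IU0.
set IW := I W in IPW_le IPW_ge *; set IPW := I _ in IPW_le IPW_ge *.
move=> /(_ (P U * IW - IPW)); rewrite subr_ge0 => /(_ IPW_le) h1.
move=> /(_ (IPW - P L * IW)); rewrite subr_ge0 => /(_ IPW_ge) h2.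
nra.
Qed.

End by_parts.

(** * Hoeffding's covariance formula *)

(** The optimal choice is [l = sqrt (B / A)]. Replacing [A] and [B] by [A + e] and [B + e] covers
    the case where one of them vanishes. *)
Lemma ler_sqrt_of_scaling (R : rcfType) (x A B : R) : 0 <= A -> 0 <= B ->
  (forall l, 0 < l -> 2 * x <= l * A + l^-1 * B) -> x <= Num.sqrt (A * B).
Proof.
move=> A0 B0 H; have [x0|x0] := leP x 0; first exact: le_trans (sqrtr_ge0 _).
have AB0 e : 0 < e -> x <= Num.sqrt ((A + e) * (B + e)).
  move=> e0; have Ae : 0 < A + e by rewrite ltr_wpDl.
  have Be : 0 < B + e by rewrite ltr_wpDl.
  pose l := Num.sqrt (B + e) / Num.sqrt (A + e).
  have sA : 0 < Num.sqrt (A + e) by rewrite sqrtr_gt0.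
  have sB : 0 < Num.sqrt (B + e) by rewrite sqrtr_gt0.
  have l0 : 0 < l by rewrite divr_gt0.
  rewrite -(ler_pM2l (ltr0n _ 2)); apply: le_trans (H l l0) _.
  apply: (@le_trans _ _ (l * (A + e) + l^-1 * (B + e))).
    by apply: lerD; rewrite ler_pM2l ?invr_gt0// lerDl ltW.
  have -> : l * (A + e) = Num.sqrt (A + e) * Num.sqrt (B + e).
    by rewrite -[X in l * X](sqr_sqrtr (ltW Ae)) /l; field; rewrite gt_eqF.
  have -> : l^-1 * (B + e) = Num.sqrt (A + e) * Num.sqrt (B + e).
    by rewrite -[X in _ * X](sqr_sqrtr (ltW Be)) /l; field; rewrite !gt_eqF.
  by rewrite sqrtrM ?(ltW Ae)// mulr2n mulrDl mul1r.
suff xAB : x ^+ 2 <= A * B.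
  by rewrite -(ger0_norm (ltW x0)) -sqrtr_sqr ler_sqrt// mulr_ge0.
rewrite leNgt; apply/negP => xAB.
pose d := x ^+ 2 - A * B; have d0 : 0 < d by rewrite subr_gt0.
(* Since [e <= 1], [(A + e) * (B + e) <= A * B + e * (A + B + 1) <= A * B + d / 2 < x ^+ 2]. *)
pose e := Num.min 1 (d / (2 * (A + B + 1))).
have AB1 : 0 < 2 * (A + B + 1) by rewrite mulr_gt0// ltr_wpDl// addr_ge0.
have e0 : 0 < e by rewrite lt_min ltr01 divr_gt0.
have e1 : e <= 1 by rewrite ge_min lexx.
have ed : e * (2 * (A + B + 1)) <= d by rewrite -ler_pdivlMr// ge_min lexx orbT.
have ABe : 0 <= (A + e) * (B + e) by rewrite mulr_ge0// addr_ge0// ltW.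
have := AB0 e e0; rewrite -(ger0_norm (ltW x0)) -sqrtr_sqr ler_sqrt//.
by rewrite leNgt => /negP; apply; rewrite /d in ed; nra.
Qed.

Section hoeffding.
Context (R : realType) (L U : R) (LU : L < U).
Local Notation J := (itv_int L U).

(** The primitive of [phi] vanishing at [L], as a superposition of the indicators of [s <= x] over a
    fixed interval; in this form Fubini exchanges it with the integral over the box. *)
Definition prim (phi : R -> R) (x : R) : R := J (fun s => phi s * (s <= x)%R%:R).

Lemma bounded_measurable_ler : bounded_measurable (fun p : R * R => (p.2 <= p.1)%R%:R : R).
Proof.
split; last by exists 1 => p; case: (p.2 <= p.1); rewrite /= ?normr1 ?normr0 ?lexx ?ler01.
rewrite (_ : (fun _ => _) = (fun b : bool => b%:R : R) \o (fun p : R * R => p.2 <= p.1)) //.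
apply: measurableT_comp => //.
by apply: measurable_fun_ler.
Qed.

Lemma bounded_measurable_ler_comp d (T : measurableType d) (f g : T -> R) :
  measurable_fun setT f -> measurable_fun setT g ->
  bounded_measurable (fun p => (f p <= g p)%R%:R : R).
Proof.
move=> mf mg.
apply: (bounded_measurable_comp (phi := fun p => (g p, f p)) bounded_measurable_ler).
exact/measurable_fun_pair.
Qed.

Lemma bounded_measurable_prim phi : bounded_measurable phi -> bounded_measurable (prim phi).
Proof.
move=> bphi; pose F (p : R * R) := phi p.2 * (p.2 <= p.1)%R%:R.
have bF : bounded_measurable F.
  apply: bounded_measurableM; last exact: bounded_measurable_ler.
  exact: (bounded_measurable_comp bphi (@measurable_snd _ _ _ _)).
exact: (bounded_measurable_itv_int L U bF).
Qed.

Lemma primE phi x : x <= U ->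
  prim phi x = parameterized_integral lebesgue_measure L x phi.
Proof.
move=> xU; rewrite /prim /itv_int /parameterized_integral.
rewrite Rintegral_mkcond [RHS]Rintegral_mkcond; congr Rintegral.
apply/funext => s; rewrite !patchE !mem_setE !in_itv/=.
have [sx|xs] := leP s x; last by rewrite andbF mulr0 if_same.
by rewrite (le_trans sx xU) andbT mulr1.
Qed.

Lemma prim1 x : L <= x <= U -> prim (fun=> 1) x = x - L.
Proof.
move=> /andP[Lx xU]; rewrite primE// /parameterized_integral Rintegral_cst//.
rewrite mul1r /= lebesgue_measure_itv/= lte_fin.
case: ltP => [_|xL]; first by rewrite -EFinD.
by rewrite (@le_anti _ _ x L) ?subrr ?xL.
Qed.

Lemma prim_continuous (phi : R -> R) : continuous phi ->
  let P := fun x => parameterized_integral lebesgue_measure L x phi in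
  derivable_oo_LRcontinuous P L U /\ {in `]L, U[, derive1 P =1 phi}.
Proof.
move=> cphi P.
have iphi x : lebesgue_measure.-integrable `[L, x] (EFin \o phi).
  apply: continuous_compact_integrable; first exact: segment_compact.
  exact: continuous_subspaceT.
have dP x : L < x -> derivable P x 1 /\ derive1 P x = phi x.
  move=> Lx; apply: (@continuous_FTC1_closed _ phi L x (x + 1)) => //.
    by rewrite ltrDl.
  exact: cphi.
split; last by move=> x; rewrite in_itv/= => /andP[Lx _]; have [] := dP x Lx.
have := parameterized_integral_continuous (ltW LU) (iphi U).
move=> /(continuous_within_itvP _ LU)[_ cL cU]; split => //.
by move=> x; rewrite in_itv/= => /andP[Lx _]; have [] := dP x Lx.
Qed.

Lemma prim_ge0_homo phi x y : bounded_measurable phi -> (forall s, 0 <= phi s) ->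
  x <= y -> prim phi x <= prim phi y.
Proof.
move=> bphi phi0 xy.
have b w : bounded_measurable (fun s => phi s * (s <= w)%R%:R).
  apply: bounded_measurableM => //; apply: bounded_measurable_ler_comp => //.
apply: le_itv_int => // s _; apply: ler_wpM2l => //.
by have [sx|_] := leP s x; rewrite ?ler0n// (le_trans sx xy).
Qed.

Context (n : nat) (W : n.-tuple R -> R).
Hypotheses (bW : bounded_measurable W) (W_ge0 : forall z, 0 <= W z).
Hypothesis W_lsm : forall s t u w, is_meet_join s t u w -> W s * W t <= W w * W u.
Variable c : R -> R.
Hypotheses (mc : measurable_fun setT c) (c_homo : {homo c : x y / x <= y}).
Hypothesis c_itv : forall x, L <= c x <= U.

Local Notation I := (box_int L U).
Local Notation C := (wcov L U W).

Let Z (a : 'I_n) (z : n.-tuple R) := c (tnth z a).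

Let mZ a : measurable_fun setT (Z a).
Proof. by apply: measurableT_comp => //; exact: measurable_tnth. Qed.

Let ind a (s : R) (z : n.-tuple R) : R := (s <= Z a z)%R%:R.

Let bind a s : bounded_measurable (ind a s).
Proof. exact: bounded_measurable_ler_comp. Qed.

Let bprim a phi : bounded_measurable phi ->
  bounded_measurable (fun z => prim phi (Z a z)).
Proof. by move=> /bounded_measurable_prim bP; exact: bounded_measurable_comp. Qed.

Let box_int_prim a phi H : bounded_measurable phi -> bounded_measurable H ->
  I (fun z => prim phi (Z a z) * H z) = J (fun s => phi s * I (fun z => ind a s z * H z)).
Proof.
move=> bphi bH; pose F (p : R * n.-tuple R) := phi p.1 * (ind a p.1 p.2 * H p.2).
have bF : bounded_measurable F.
  apply: bounded_measurableM; last apply: bounded_measurableM.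
  - exact: (bounded_measurable_comp bphi (@measurable_fst _ _ _ _)).
  - apply: bounded_measurable_ler_comp => //.
    by apply: measurableT_comp => //; exact: mZ.
  - exact: (bounded_measurable_comp bH (@measurable_snd _ _ _ _)).
transitivity (J (fun s => I (fun z => F (s, z)))).
  rewrite [RHS](box_int_fubini L U bF); congr box_int; apply/funext => z.
  rewrite /prim mulrC -itv_intZ; last first.
    apply: bounded_measurableM => //; exact: bounded_measurable_ler_comp.
  by congr itv_int; apply/funext => s; rewrite /F /ind /=; ring.
congr itv_int; apply/funext => s; rewrite -box_intZ//.
exact: bounded_measurableM.
Qed.

Let bI a H : bounded_measurable H -> bounded_measurable (fun s => I (fun z => ind a s z * H z)).
Proof.
move=> bH; pose F (p : R * n.-tuple R) := ind a p.1 p.2 * H p.2.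
have bF : bounded_measurable F.
  apply: bounded_measurableM.
  - apply: bounded_measurable_ler_comp => //.
    by apply: measurableT_comp => //; exact: mZ.
  - exact: (bounded_measurable_comp bH (@measurable_snd _ _ _ _)).
exact: (bounded_measurable_box_int L U bF).
Qed.

(** One half of Hoeffding's formula: covariance is linear, and [prim phi] is a mixture of
    indicators. Applying it in both arguments gives the double integral. *)
Lemma wcov_prim a phi G : bounded_measurable phi -> bounded_measurable G ->
  C (fun z => prim phi (Z a z)) G = J (fun s => phi s * C (ind a s) G).
Proof.
move=> bphi bG; rewrite /wcov.
have bGW := bounded_measurableM bG bW.
have bIG := bI a bGW; have bIW := bI a bW.
have -> : I (fun z => prim phi (Z a z) * G z * W z)
    = J (fun s => phi s * I (fun z => ind a s z * (G z * W z))).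
  rewrite -box_int_prim//; congr box_int; apply/funext => z; ring.
rewrite box_int_prim// -itv_intZ; last by bounded_measurable.
rewrite mulrC -itv_intZ; last by bounded_measurable.
rewrite -itv_intB; [|by apply: bounded_measurableZ; bounded_measurable..].
congr itv_int; apply/funext => s.
under [X in _ = phi s * (_ * I X - _)]eq_fun do rewrite -mulrA.
ring.
Qed.

Lemma bounded_measurable_wcov a G : bounded_measurable G ->
  bounded_measurable (fun s => C (ind a s) G).
Proof.
move=> bG; have bGW := bounded_measurableM bG bW.
have bIG := bI a bGW; have bIW := bI a bW.
rewrite /wcov; under eq_fun do (under [X in _ * I X - _]eq_fun do rewrite -mulrA).
by bounded_measurable.
Qed.

Lemma wcov_primr a G phi : bounded_measurable phi -> bounded_measurable G ->
  C G (fun z => prim phi (Z a z)) = J (fun s => phi s * C G (ind a s)).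
Proof.
move=> bphi bG; rewrite (wcovC L U W G) (wcov_prim a bphi bG).
have -> // : (fun s => phi s * C (ind a s) G) = (fun s => phi s * C G (ind a s)).
by apply/funext => s; rewrite (wcovC L U W (ind a s)).
Qed.

Lemma wcov_prim2 a b phi gamma : bounded_measurable phi -> bounded_measurable gamma ->
  C (fun z => prim phi (Z a z)) (fun z => prim gamma (Z b z)) =
  J (fun s => phi s * J (fun t => gamma t * C (ind a s) (ind b t))).
Proof.
move=> bphi bgamma; rewrite wcov_prim//; last exact: bprim.
have -> // : (fun s => phi s * C (ind a s) (fun z => prim gamma (Z b z))) =
  (fun s => phi s * J (fun t => gamma t * C (ind a s) (ind b t))).
by apply/funext => s; rewrite (wcov_primr b bgamma (bind a s)).
Qed.

Lemma bounded_measurable_wcov_prim a b gamma : bounded_measurable gamma ->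
  bounded_measurable (fun s => J (fun t => gamma t * C (ind a s) (ind b t))).
Proof.
move=> bgamma.
have -> : (fun s => J (fun t => gamma t * C (ind a s) (ind b t))) =
    (fun s => C (ind a s) (fun z => prim gamma (Z b z))).
  by apply/funext => s; rewrite (wcov_primr b bgamma (bind a s)).
by apply: bounded_measurable_wcov; exact: bprim.
Qed.

Lemma ind_nondecreasing a s : coord_nondecreasing (ind a s).
Proof.
move=> x y xy; rewrite /ind ler_nat; case: (leP s (Z a x)) => // sx.
by rewrite (le_trans sx)//; exact: c_homo.
Qed.

(* Hoeffding's formula writes the covariance as a double integral against the
   kernel [C (ind a s) (ind b t)], nonnegative by FKG, so [2 phi gamma <=
   l phi^2 + gamma^2 / l] can be used under the integral. *)
Lemma wcov_prim_amgm a b phi gamma l : 0 < l ->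
  bounded_measurable phi -> bounded_measurable gamma ->
  2 * C (fun z => prim phi (Z a z)) (fun z => prim gamma (Z b z)) <=
  l * C (fun z => prim (fun s => phi s ^+ 2) (Z a z)) (Z b) +
  l^-1 * C (fun z => prim (fun s => gamma s ^+ 2) (Z b z)) (Z a).
Proof.
move=> l0 bphi bgamma.
have bphi2 : bounded_measurable (fun s => phi s ^+ 2) by exact: bounded_measurableM.
have bgamma2 : bounded_measurable (fun s => gamma s ^+ 2) by exact: bounded_measurableM.
have b1 := bounded_measurable_cst R (1 : R).
have CZ e psi (be : bounded_measurable psi) d :
    C (fun z => prim psi (Z e z)) (Z d) =
    C (fun z => prim psi (Z e z)) (fun z => prim (fun=> 1) (Z d z)).
  have bZ : bounded_measurable (Z d).
    split => //; exists (`|L| + `|U|) => z; have /andP[h1 h2] := c_itv (tnth z d).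
    have := ler_norm U; have := ler_norm (- L); have := normr_ge0 L.
    have := normr_ge0 U; rewrite normrN ler_norml /Z => *; apply/andP; split; lra.
  transitivity (C (fun z => prim psi (Z e z)) (fun z => Z d z - L)).
    rewrite wcovB//; [|exact: bprim|exact: bounded_measurable_cst].
    by rewrite wcov_cst ?subr0//; exact: bprim.
  by congr wcov; apply/funext => z; rewrite prim1 ?c_itv.
rewrite (CZ _ _ bphi2) (CZ _ _ bgamma2) [X in _ + _ * X]wcovC !wcov_prim2//.
pose K s t := C (ind a s) (ind b t).
have K0 s t : 0 <= K s t by apply: fkg => //; exact: ind_nondecreasing.
have bK s : bounded_measurable (K s).
  have -> : K s = fun t => C (ind b t) (ind a s).
    by apply/funext => t; rewrite /K (wcovC L U W (ind a s)).
  exact: bounded_measurable_wcov.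
have bJ g (bg : bounded_measurable g) : bounded_measurable (fun s => J (fun t => g t * K s t)).
  exact: bounded_measurable_wcov_prim.
have bJ1 := bJ _ b1; have bJg := bJ _ bgamma; have bJg2 := bJ _ bgamma2.
rewrite -!itv_intZ; [|by bounded_measurable..].
rewrite -itv_intD; [|by apply: bounded_measurableZ; bounded_measurable..].
have bs s g (bg : bounded_measurable g) : bounded_measurable (fun t => g t * K s t).
  exact: bounded_measurableM.
apply: le_itv_int => [||s _].
- by apply: bounded_measurableZ; bounded_measurable.
- by apply: bounded_measurableD; apply: bounded_measurableZ; bounded_measurable.
rewrite mulrA -itv_intZ; last exact: bs.
rewrite !mulrA -!itv_intZ; [|exact: bs..].
rewrite -itv_intD; [|by apply: bounded_measurableZ; exact: bs..].
have bKs := bK s.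
apply: le_itv_int => [||t _]; [bounded_measurable..|].
rewrite -/(K s t); move: (K s t) (K0 s t) => k k0.
have h : 0 <= l^-1 * (l * phi s - gamma t) ^+ 2 * k.
  by rewrite mulr_ge0// mulr_ge0 ?sqr_ge0// invr_ge0 ltW.
rewrite -subr_ge0; apply: le_trans h _; rewrite le_eqVlt; apply/orP; left.
by apply/eqP; field; rewrite gt_eqF.
Qed.

(** The hypothesis is required in both orders of [a] and [b], as the bound to be optimised over [l]
    contains one term with source [a] and one with source [b]. *)
Lemma wcov_prim_sqrt a b (phi gamma : R -> R) (kappa : R) : 0 <= kappa ->
  bounded_measurable phi -> bounded_measurable gamma ->
  continuous phi -> continuous gamma ->
  (forall d e, (d = a /\ e = b) \/ (d = b /\ e = a) ->
     forall psi : R -> R, bounded_measurable psi -> continuous psi -> (forall s, 0 <= psi s) ->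
     C (fun z => prim psi (Z d z)) (Z e) <= kappa * I (fun z => psi (Z d z) * W z)) ->
  `|C (fun z => prim phi (Z a z)) (fun z => prim gamma (Z b z))| <=
  kappa * Num.sqrt (I (fun z => phi (Z a z) ^+ 2 * W z) * I (fun z => gamma (Z b z) ^+ 2 * W z)).
Proof.
move=> k0 bphi bgamma cphi cgamma H.
have b2 (f : R -> R) : bounded_measurable f -> bounded_measurable (fun s => f s ^+ 2).
  by move=> bf; exact: bounded_measurableM.
have c2 (f : R -> R) : continuous f -> continuous (fun s => f s ^+ 2).
  by move=> cf x; exact: (continuousM (cf x) (cf x)).
set A := I (fun z => phi (Z a z) ^+ 2 * W z).
set B := I (fun z => gamma (Z b z) ^+ 2 * W z).
have A0 : 0 <= A by apply: box_int_ge0 => z _; rewrite mulr_ge0 ?sqr_ge0.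
have B0 : 0 <= B by apply: box_int_ge0 => z _; rewrite mulr_ge0 ?sqr_ge0.
have HA := H a b (or_introl (conj erefl erefl)) _ (b2 _ bphi) (c2 _ cphi) (fun s => sqr_ge0 _).
have HB := H b a (or_intror (conj erefl erefl)) _ (b2 _ bgamma) (c2 _ cgamma) (fun s => sqr_ge0 _).
(* The bound sees [f] only through its square, so it serves for both [phi] and [- phi], which gives
   the absolute value. *)
have main f (bf : bounded_measurable f) : (forall s, f s ^+ 2 = phi s ^+ 2) ->
    C (fun z => prim f (Z a z)) (fun z => prim gamma (Z b z)) <= kappa * Num.sqrt (A * B).
  move=> fphi.
  rewrite -[kappa](ger0_norm k0) -sqrtr_sqr -sqrtrM ?sqr_ge0//.
  rewrite expr2 mulrACA; apply: ler_sqrt_of_scaling; rewrite ?mulr_ge0// => l l0.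
  apply: le_trans (wcov_prim_amgm a b l0 bf bgamma) _.
  rewrite (_ : (fun s => f s ^+ 2) = fun s => phi s ^+ 2); last exact/funext.
  by rewrite lerD// ler_pM2l// invr_gt0.
rewrite ler_norml main// andbT.
have := main (fun s => - phi s) (bounded_measurableN bphi) (fun s => sqrrN _).
rewrite (_ : C _ _ = - C (fun z => prim phi (Z a z)) (fun z => prim gamma (Z b z))); first by rewrite lerNl.
rewrite !wcov_prim2//; last exact: bounded_measurableN.
rewrite -mulN1r -itv_intZ; last first.
  by apply: bounded_measurableM => //; exact: bounded_measurable_wcov_prim.
by apply: eq_Rintegral => s _; ring.
Qed.

End hoeffding.

(** * Interval matrices *)

Section max_principle.
Context (R : realFieldType).

(** At a site [a] where [xi / h] is maximal, the signs of the off-diagonal entries give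
    [(A xi)_a >= r a * (A h)_a]; dividing by [(A h)_a > 0] bounds the maximum by [M]. *)
Lemma max_principle (T : finType) (A : T -> T -> R) (h xi : T -> R) (M : R) :
  (forall a b, a != b -> A a b <= 0) -> (forall a, 0 < h a) ->
  (forall a, 0 < \sum_b A a b * h b) ->
  (forall a, \sum_b A a b * xi b <= M * \sum_b A a b * h b) ->
  forall a, xi a <= M * h a.
Proof.
move=> A_le0 h0 Ah0 Axi a0.
pose r a := xi a / h a.
have [a _ amax] := @arg_maxP _ _ _ a0 predT r erefl.
rewrite -ler_pdivrMr//; apply: le_trans (amax a0 isT) _.
rewrite -(ler_pM2r (Ah0 a)); apply: le_trans (Axi a).
rewrite mulr_sumr; apply: ler_sum => b _.
have [<-|ab] := eqVneq a b; first by rewrite mulrCA /r divfK ?gt_eqF.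
rewrite mulrCA; apply: ler_wnM2l; first exact: A_le0.
by rewrite -ler_pdivrMr//; exact: amax.
Qed.

End max_principle.

Section interval_sums.
Context (R : realDomainType).

(** The indices [i < j] are particles, and the pair stands for the block of spacings
    [i, ..., j - 1]. Energy, force and Hessian bound are all sums of this shape. *)
Definition interval_sum (n : nat) (m : option nat) (g : nat -> nat -> R) : R :=
  \sum_(i < n.+1) \sum_(j < n.+1 | (i < j)%N && in_range m (j - i)) g i j.

Lemma eq_interval_sum n m (f g : nat -> nat -> R) :
  (forall i j, (i < j <= n)%N -> in_range m (j - i) -> f i j = g i j) ->
  interval_sum n m f = interval_sum n m g.
Proof.
move=> fg; apply: eq_bigr => i _; apply: eq_bigr => j /andP[ij mij].
by apply: fg => //; rewrite ij -ltnS ltn_ord.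
Qed.

Lemma ler_interval_sum n m (f g : nat -> nat -> R) :
  (forall i j, (i < j <= n)%N -> in_range m (j - i) -> f i j <= g i j) ->
  interval_sum n m f <= interval_sum n m g.
Proof.
move=> fg; apply: ler_sum => i _; apply: ler_sum => j /andP[ij mij].
by apply: fg => //; rewrite ij -ltnS ltn_ord.
Qed.

Lemma interval_sumB n m (f g : nat -> nat -> R) :
  interval_sum n m (fun i j => f i j - g i j) = interval_sum n m f - interval_sum n m g.
Proof. by rewrite -sumrB; apply: eq_bigr => i _; rewrite -sumrB. Qed.

Lemma interval_sumZ n m (x : R) (f : nat -> nat -> R) :
  interval_sum n m (fun i j => x * f i j) = x * interval_sum n m f.
Proof. by rewrite mulr_sumr; apply: eq_bigr => i _; rewrite mulr_sumr. Qed.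

Lemma interval_sum_sum n m (T : finType) (f : T -> nat -> nat -> R) :
  \sum_t interval_sum n m (f t) = interval_sum n m (fun i j => \sum_t f t i j).
Proof.
by rewrite exchange_big; apply: eq_bigr => i _; rewrite exchange_big.
Qed.

(* There are at most [k] intervals of length [k] through a given site. *)
Lemma interval_sum_le n m (a : 'I_n) (f : nat -> R) : (forall k, 0 <= f k) ->
  interval_sum n m (fun i j => (i <= a < j)%N%:R * f (j - i)%N) <=
  \sum_(k < n.+1) k%:R * f k.
Proof.
move=> f0.
apply: (@le_trans _ _ (\sum_(i < n.+1) \sum_(k < n.+1) (i <= a < i + k)%N%:R * f k)).
  apply: ler_sum => i _.
  pose F (k : nat) := (i <= a < i + k)%N%:R * f k.
  have F0 k : 0 <= F k by rewrite mulr_ge0.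
  apply: (@le_trans _ _ (\sum_(j < n.+1 | (i < j)%N) F (j - i)%N)).
    rewrite [leLHS]big_mkcondr/=; apply: ler_sum => j ij; case: ifP => // _.
    by rewrite /F subnKC// ltnW.
  rewrite -(big_mkord (fun j => (i < j)%N) (fun j => F (j - i)%N)).
  rewrite -(big_mkord xpredT F).
  rewrite (big_cat_nat (leq0n i) (ltnW (ltn_ord i))) /=.
  rewrite big_nat_cond big1 ?add0r; last first.
    by move=> j /andP[/andP[_ ji] ij]; move: (ltn_trans ij ji); rewrite ltnn.
  rewrite -{1}[i : nat]add0n big_addn.
  rewrite [leLHS]big_mkcond/=.
  apply: (@le_trans _ _ (\sum_(0 <= k < n.+1 - i) F k)).
    by apply: ler_sum => k _; case: ifP => // _; rewrite addnK.
  rewrite [leRHS](big_cat_nat (leq0n (n.+1 - i)) (leq_subr i _))/=.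
  by rewrite lerDl sumr_ge0.
rewrite exchange_big; apply: ler_sum => k _ /=.
rewrite -mulr_suml ler_wpM2r//.
rewrite -natr_sum ler_nat.
rewrite (eq_bigr (fun i : 'I_n.+1 => if (i <= a < i + k)%N then 1%N else 0%N)); last first.
  by move=> i _; case: (_ && _).
rewrite -(big_mkord xpredT (fun i => if (i <= a < i + k)%N then 1%N else 0%N)).
rewrite -big_mkcond/= sum1_count.
apply: (@leq_trans (size (iota (a.+1 - k) k))); last by rewrite size_iota.
rewrite -size_filter; apply: uniq_leq_size; first exact/filter_uniq/iota_uniq.
by move=> i; rewrite mem_filter !mem_iota => /andP[]; lia.
Qed.

(** The point where [m >= 1] enters: blocks of a single spacing interact, and they alone supply the
    positive diagonal of the matrix. *)
Lemma interval_sum_range n m (g : nat -> nat -> R) : m <> Some 0%N ->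
  interval_sum n m (fun i j => (j - i == 1)%N%:R * g i j) = \sum_(i < n) g i i.+1.
Proof.
move=> m0.
have r1 : in_range m 1 by case: m m0 => [[|m]|] //=.
rewrite /interval_sum big_ord_recr/= [X in _ + X]big1 ?addr0; last first.
  by move=> j /andP[nj _]; move: (leq_trans nj (ltn_ord j)); rewrite ltnn.
apply: eq_bigr => i _.
have iS : (i.+1 < n.+1)%N by rewrite ltnS.
rewrite (bigD1 (Ordinal iS)) /=; last by rewrite ltnSn subSnn.
rewrite subSnn eqxx mul1r big1 ?addr0// => j /andP[/andP[ij _] nj].
rewrite (_ : (j - i == 1)%N = false) ?mul0r//; apply/eqP => ji1.
move/negP: nj; apply; apply/eqP/val_inj => /=; lia.
Qed.

End interval_sums.

(** * A supersolution with power-law decay *)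

Section supersolution.
Context (R : realType).

(** With [(1 + t) ^ s = q], either [Y <= t X] and the first term suffices, or [X < Y / t] and the
    second one does. The constant before [X ^ s] can be as close to [1] as desired. *)
Lemma powR_add_le (s q : R) : 0 < s -> 1 < q -> exists2 K : R, 0 < K &
  forall X Y, 0 <= X -> 0 <= Y -> (X + Y) `^ s <= q * X `^ s + K * Y `^ s.
Proof.
move=> s0 q1; have q0 : 0 < q by exact: lt_trans q1.
pose t := q `^ s^-1 - 1.
have t0 : 0 < t.
  rewrite subr_gt0 -(powRr0 q) /powR gt_eqF//= ltr_expR mul0r.
  by rewrite mulr_gt0 ?invr_gt0// ln_gt0.
have q1t : (1 + t) `^ s = q by rewrite /t addrC subrK -powRrM mulVf ?gt_eqF// powRr1 ?ltW.
exists ((1 + t^-1) `^ s); first by rewrite powR_gt0// addr_gt0// invr_gt0.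
move=> X Y X0 Y0; have [YX|XY] := leP Y (t * X).
  apply: (@le_trans _ _ (q * X `^ s)); last by rewrite lerDl mulr_ge0 ?powR_ge0.
  rewrite -q1t -powRM//; last by rewrite addr_ge0// ltW.
  apply: ge0_ler_powR; rewrite ?nnegrE ?(ltW s0)//.
  - exact: addr_ge0.
  - by rewrite mulr_ge0// addr_ge0// ltW.
  - by rewrite mulrDl mul1r lerD2l.
apply: (@le_trans _ _ ((1 + t^-1) `^ s * Y `^ s)); last first.
  by rewrite lerDr mulr_ge0 ?powR_ge0// ltW.
rewrite -powRM//; last by rewrite addr_ge0// invr_ge0 ltW.
apply: ge0_ler_powR; rewrite ?nnegrE ?(ltW s0)//.
- exact: addr_ge0.
- by rewrite mulr_ge0// addr_ge0// invr_ge0 ltW.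
- rewrite mulrDl mul1r addrC lerD2l mulrC ler_pdivlMr// mulrC; exact: ltW.
Qed.

Lemma sum_tail_inv_sqr (d N : nat) : (0 < d)%N ->
  \sum_(k < N) (d < k)%N%:R * (k%:R : R) ^- 2 <= d%:R^-1.
Proof.
move=> d0.
(* Telescoped form of the bound, from [k ^- 2 <= (k - 1)^-1 - k^-1], strong enough for the
   induction. *)
suff : \sum_(k < N) (d < k)%N%:R * (k%:R : R) ^- 2 <=
    if (d < N)%N then d%:R^-1 - N.-1%:R^-1 else 0.
  move=> /le_trans -> //; case: ifP => _; last by rewrite invr_ge0.
  by rewrite gerBl invr_ge0.
elim: N => [|N IH]; first by rewrite big_ord0.
rewrite big_ord_recr /=; have [dN|Nd|dN] := ltngtP d N.
- rewrite ltnS (ltnW dN); rewrite dN in IH; rewrite mul1r.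
  have N1 : (0 < N.-1)%N by lia.
  have N10 : (0 : R) < N.-1%:R by rewrite ltr0n.
  have EN : (N%:R : R) = N.-1%:R + 1 by rewrite natr1 prednK//; lia.
  apply: (le_trans (lerD IH (lexx _))); rewrite EN -subr_ge0.
  have -> : d%:R^-1 - (N.-1%:R + 1)^-1 - (d%:R^-1 - N.-1%:R^-1 + (N.-1%:R + 1) ^- 2)
     = (N.-1%:R * (N.-1%:R + 1) ^+ 2)^-1 :> R.
    by field; rewrite !gt_eqF// ?ltr0n// addr_gt0.
  by rewrite invr_ge0 mulr_ge0 ?ltW// exprn_ge0// addr_ge0 ?ltW.
- rewrite ltnS leqNgt Nd /= mul0r addr0.
  by move: IH; rewrite ltnNge (ltnW Nd).
- by subst N; rewrite ltnSn /= subrr mul0r addr0; move: IH; rewrite ltnn.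
Qed.

Lemma sum_inv_sqr_affine (e : R) (n : nat) : 0 < e ->
  \sum_(d < n) (1 + e * d%:R) ^- 2 <= 1 + e^-1.
Proof.
move=> e0.
(* The right side is [1] plus the integral of [(1 + e x) ^- 2] from [0] to [k]. *)
suff H k : \sum_(d < k.+1) (1 + e * d%:R) ^- 2 <= 1 + e^-1 - (e * (1 + e * k%:R))^-1.
  case: n => [|n]; first by rewrite big_ord0 addr_ge0// invr_ge0 ltW.
  apply: le_trans (H n) _; rewrite gerBl invr_ge0 mulr_ge0 ?ltW//.
  by rewrite ltr_pwDl// mulr_ge0// ltW.
have p m : 0 < 1 + e * m%:R by rewrite ltr_pwDl// mulr_ge0// ltW.
elim: k => [|k IH].
  by rewrite big_ord1 /= !mulr0 !addr0 mulr1 addrK expr1n invr1.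
rewrite big_ord_recr /=; apply: (le_trans (lerD IH (lexx _))).
have := p k; have := p k.+1; rewrite -natr1 mulrDr mulr1 addrA.
set x := 1 + e * k%:R => xe0 x0; rewrite -subr_ge0.
have -> : 1 + e^-1 - (e * (x + e))^-1 - (1 + e^-1 - (e * x)^-1 + (x + e) ^- 2)
   = e / (x * (x + e) ^+ 2).
  by field; rewrite !gt_eqF.
by rewrite divr_ge0 ?(ltW e0)// mulr_ge0 ?(ltW x0)// exprn_ge0// ltW.
Qed.

Definition dst (a b : nat) : nat := (a - b + (b - a))%N.

Lemma dst_triangle (a b i : nat) : (dst a i <= dst b i + dst a b)%N.
Proof. rewrite /dst; lia. Qed.

Lemma dstnn (a : nat) : dst a a = 0%N.
Proof. by rewrite /dst subnn. Qed.

Lemma dst_gt0 (a b : nat) : a <> b -> (0 < dst a b)%N.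
Proof. rewrite /dst; lia. Qed.

(** Each distance from [i] is attained at most twice, once on either side. *)
Lemma sum_dst_le (n : nat) (i : 'I_n) (f : nat -> R) : (forall d, 0 <= f d) ->
  \sum_(b < n) f (dst b i) <= 2 * \sum_(d < n) f d.
Proof.
move=> f0; rewrite -(big_mkord xpredT (fun b => f (dst b i))).
rewrite -(big_mkord xpredT f).
rewrite (big_cat_nat (leq0n i) (ltnW (ltn_ord i))) /= mulr2n mulrDl mul1r.
apply: lerD.
  rewrite big_nat_rev /= add0n.
  apply: (@le_trans _ _ (\sum_(0 <= d < i) f d.+1)).
    rewrite le_eqVlt; apply/orP; left; apply/eqP; apply: eq_big_nat => d /andP[_ di].
    by congr f; rewrite /dst; lia.
  apply: (@le_trans _ _ (\sum_(0 <= d < i.+1) f d)).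
    by rewrite big_nat_recl// lerDr.
  by rewrite [leRHS](big_cat_nat (leq0n i.+1) (ltn_ord i))/= lerDl sumr_ge0.
rewrite -{1}[i : nat]add0n big_addn.
apply: (@le_trans _ _ (\sum_(0 <= d < n - i) f d)).
  rewrite le_eqVlt; apply/orP; left; apply/eqP; apply: eq_big_nat => d _.
  by congr f; rewrite /dst; lia.
by rewrite [leRHS](big_cat_nat (leq0n (n - i)) (leq_subr i n))/= lerDl sumr_ge0.
Qed.

(** The Hessian of the quadratic energy in which a block of [k] spacings of total length [l] costs
    [c k * l ^+ 2 / 2]. *)
Definition interval_matrix (n : nat) (m : option nat) (c : nat -> R) (a b : 'I_n) : R :=
  interval_sum n m (fun i j =>
    (i <= a < j)%N%:R * (i <= b < j)%N%:R * c (j - i)%N).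

Context (s delta Ca : R) (c : nat -> R).
Hypotheses (s2 : 2 < s) (delta0 : 0 < delta) (Ca0 : 0 <= Ca).
Hypothesis c_le0 : forall k, (2 <= k)%N -> c k <= 0.
Hypothesis c_ge : forall k, (2 <= k)%N -> - c k * k%:R `^ (s + 2) <= Ca.
Hypothesis c_sum : forall n, delta <= c 1 + \sum_(2 <= k < n) k%:R ^+ 2 * c k.

Let e k := if (2 <= k)%N then - c k else 0.

Let e_ge0 k : 0 <= e k.
Proof. by rewrite /e; case: ifP => // k2; rewrite oppr_ge0 c_le0. Qed.

Let e_le k : e k * k%:R `^ (s + 2) <= Ca.
Proof. by rewrite /e; case: ifP => k2; rewrite ?mul0r// c_ge. Qed.

Let e_sum n : \sum_(k < n) k%:R ^+ 2 * e k <= c 1 - delta.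
Proof.
rewrite lerBrDl -lerBrDr; apply: le_trans (c_sum n) _.
rewrite lerD2l -(big_mkord xpredT (fun k => k%:R ^+ 2 * e k)) -sumrN.
case: n => [|[|n]].
- by rewrite !big_geq.
- by rewrite big_geq// big_nat1 /e /= mulr0 oppr0.
- rewrite [leRHS](@big_cat_nat _ _ _ 2)//= [X in _ <= X + _]big_nat_recr//= big_nat1.
  rewrite /e /= !mulr0 oppr0 !add0r; apply: ler_sum_nat => k /andP[k2 _].
  by rewrite k2 mulrN opprK.
Qed.

Let B n m := interval_matrix (n := n) m e.

(** Single spacings contribute [c 1] times the identity; longer blocks have [c k <= 0] and make up
    the entrywise nonnegative matrix [B]. *)
Let interval_matrixE n m (a b : 'I_n) : m <> Some 0%N ->
  interval_matrix m c a b = (a == b)%:R * c 1 - B m a b.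
Proof.
move=> m0; rewrite /interval_matrix.
rewrite (@eq_interval_sum _ _ _ _ (fun i j => (j - i == 1)%N%:R *
  ((i <= a < j)%N%:R * (i <= b < j)%N%:R * c 1) -
  (i <= a < j)%N%:R * (i <= b < j)%N%:R * e (j - i)%N)); last first.
  move=> i j /andP[ij _] _; rewrite /e; case: ifP => [k2|].
    rewrite (_ : (j - i == 1)%N = false); last by apply/eqP; lia.
    by rewrite mul0r sub0r mulrN opprK.
  by move=> k2; rewrite (_ : (j - i = 1)%N) ?eqxx /=; [ring|lia].
rewrite interval_sumB interval_sum_range//; congr (_ - _).
rewrite (bigD1 a) //= big1 ?addr0 => [|i ia]; last first.
  rewrite (_ : (i <= a < i.+1)%N = false) ?mul0r//.
  apply/negP => /andP[h1 h2]; move/negP: ia; apply.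
  by apply/eqP/val_inj => /=; lia.
rewrite leqnn ltnSn mul1r; congr (_%:R * _).
by congr nat_of_bool; apply/idP/eqP => [|->]; [move=> h; apply/val_inj => /=; lia|lia].
Qed.

Let B_ge0 n m (a b : 'I_n) : 0 <= B m a b.
Proof.
apply: sumr_ge0 => i _; apply: sumr_ge0 => j _.
by rewrite !mulr_ge0.
Qed.

(** At most [k] blocks of [k] spacings contain [a], and each contains at most [k] sites [b]: hence
    the factor [k ^+ 2] in the summability hypothesis. *)
Let B_sum n m (a : 'I_n) : \sum_b B m a b <= c 1 - delta.
Proof.
rewrite /B /interval_matrix interval_sum_sum.
apply: le_trans (e_sum n.+1).
apply: (@le_trans _ _ (interval_sum n m (fun i j =>
  (i <= a < j)%N%:R * ((j - i)%:R * e (j - i)%N)))).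
  apply: ler_interval_sum => i j /andP[ij jn] _.
  rewrite -mulr_suml -mulr_sumr -mulrA ler_wpM2l// ler_wpM2r//.
  rewrite -natr_sum ler_nat.
  rewrite (eq_bigr (fun b : 'I_n => if (i <= b < j)%N then 1%N else 0%N)); last first.
    by move=> b _; case: (_ && _).
  rewrite -(big_mkord xpredT (fun b => if (i <= b < j)%N then 1%N else 0%N)).
  rewrite -big_mkcond/= sum1_count -size_filter.
  apply: (@leq_trans (size (iota i (j - i)))); last by rewrite size_iota.
  apply: uniq_leq_size; first exact/filter_uniq/iota_uniq.
  by move=> b; rewrite mem_filter !mem_iota => /andP[]; lia.
apply: le_trans (interval_sum_le m a (f := fun k => k%:R * e k) _) _.
  by move=> k; rewrite mulr_ge0.
by apply: ler_sum => k _; rewrite expr2 mulrA.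
Qed.

(** Only blocks with [k > d] contain both sites, at most [k] for each [k]. As
    [d ^ s <= k ^ (s - 1) * d], the term for [k] is at most [Ca * d * k ^- 2], and the tail of the
    inverse squares is at most [1 / d]. *)
Let B_decay n m (a b : 'I_n) : B m a b * (dst a b)%:R `^ s <= Ca.
Proof.
have s0 : 0 < s by apply: lt_trans s2; rewrite ltr0n.
have [/eqP d0|d0] := posnP (dst a b).
  by rewrite (eqP d0) powR0 ?mulr0// gt_eqF.
set d := dst a b in d0 *.
apply: (@le_trans _ _ ((\sum_(k < n.+1) k%:R * ((d < k)%N%:R * e k)) * d%:R `^ s)).
  rewrite ler_wpM2r ?powR_ge0//.
  apply: le_trans (interval_sum_le m a (f := fun k => (d < k)%N%:R * e k) _); last first.
    by move=> k; rewrite mulr_ge0.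
  apply: ler_interval_sum => i j /andP[ij jn] _.
  rewrite -mulrA; case: (boolP (i <= a < j)%N) => ia; rewrite ?mul0r// !mul1r.
  rewrite ler_wpM2r//; case: (boolP (i <= b < j)%N) => // ib.
  suff -> : (d < j - i)%N by [].
  by move: ia ib => /andP[? ?] /andP[? ?]; rewrite /d /dst; lia.
rewrite mulr_suml.
have dR : (0 : R) < d%:R by rewrite ltr0n.
apply: (@le_trans _ _ (\sum_(k < n.+1) Ca * (d%:R * ((d < k)%N%:R * k%:R ^- 2)))); last first.
  rewrite -mulr_sumr -mulr_sumr ler_piMr// mulrC -ler_pdivlMr// mul1r.
  exact: sum_tail_inv_sqr.
apply: ler_sum => k _; case: (ltnP d k) => dk; last by rewrite !(mul0r, mulr0).
rewrite !mul1r.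
have kR : (0 : R) < k%:R by rewrite ltr0n; lia.
have powRD' (x r t : R) : 0 < x -> x `^ (r + t) = x `^ r * x `^ t.
  by move=> x0; rewrite powRD// (gt_eqF x0) implybT.
have Ek : e k * (k%:R `^ (s - 1)) * k%:R ^+ 3 <= Ca.
  apply: le_trans (e_le k); rewrite -mulrA.
  rewrite (_ : s + 2 = (s - 1) + 3); last by ring.
  by rewrite [in leRHS](powRD' _ (s - 1) 3 kR) (powR_mulrn 3 (ltW kR)).
have Ed : d%:R `^ s <= k%:R `^ (s - 1) * d%:R.
  have -> : d%:R `^ s = d%:R `^ (s - 1) * d%:R.
    by rewrite -[X in _ = _ * X](powRr1 (ltW dR)) -powRD' ?subrK.
  rewrite ler_wpM2r ?(ltW dR)//.
  have s1 : 0 <= s - 1 by rewrite subr_ge0 (le_trans _ (ltW s2))// ler1n.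
  by apply: ge0_ler_powR; rewrite ?nnegrE ?ler_nat ?(ltnW dk).
apply: (@le_trans _ _ (k%:R * e k * (k%:R `^ (s - 1) * d%:R))).
  by rewrite ler_wpM2l// mulr_ge0.
rewrite (_ : k%:R * e k * (k%:R `^ (s - 1) * d%:R) =
  (e k * k%:R `^ (s - 1) * k%:R ^+ 3) * (d%:R * k%:R ^- 2)); last first.
  by field; rewrite gt_eqF.
by rewrite ler_wpM2r// mulr_ge0 ?(ltW dR)// invr_ge0 exprn_ge0// ltW.
Qed.

(* The supersolution is [h b = (3 / delta) (1 + ep |b - i|)^(- s)]: splitting
   [(1 + ep |a - i|)^s] by [powR_add_le] charges to [B a b * |a - b|^s <= Ca] a
   term which is summable against [h] and small with [ep]. *)
Lemma interval_matrix_supersolution : exists2 c0 : R, 0 < c0 &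
  forall n m (i : 'I_n), m <> Some 0%N -> exists h : 'I_n -> R,
  [/\ forall b, 0 < h b,
      forall a, 0 < \sum_b interval_matrix m c a b * h b,
      1 <= \sum_b interval_matrix m c i b * h b
    & forall b, b != i -> h b <= c0 / (dst b i)%:R `^ s].
Proof.
have s0 : 0 < s by apply: lt_trans s2; rewrite ltr0n.
pose S := c 1 - delta.
have S0 : 0 <= S by have := e_sum 0; rewrite big_ord0.
(* [S] bounds the row sums of [B]. This [q] gives [q * S <= S + delta / 3], and [ep] below keeps the
   other error under [delta / 3]. As [c 1 = S + delta], a third of [delta] is left over, which the
   prefactor [3 / delta] turns into [1]. *)
pose q := 1 + delta / (3 * (S + 1)).
have S31 : 0 < 3 * (S + 1) by lra.
have q1 : 1 < q by rewrite /q ltrDl divr_gt0.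
have [K K0 HK] := powR_add_le s0 q1.
pose ep := Num.min 1 (delta / (12 * (K * Ca + 1))).
have KC : 0 < 12 * (K * Ca + 1) by rewrite mulr_gt0// ltr_wpDl// mulr_ge0// ltW.
have ep0 : 0 < ep by rewrite lt_min ltr01 divr_gt0.
have ep1 : ep <= 1 by rewrite ge_min lexx.
have epd : ep * (12 * (K * Ca + 1)) <= delta by rewrite -ler_pdivlMr// ge_min lexx orbT.
(* Here [s > 2] is used: summing [eta] costs a factor [1 / ep], and one power of [ep] remains to
   make the error small. *)
have eps2 : ep `^ s <= ep ^+ 2.
  by rewrite -powR_mulrn ?(ltW ep0)//; apply: ger_powR; rewrite ?ep0// ltW.
pose y (d : nat) := 1 + ep * d%:R.
have y1 d : 1 <= y d by rewrite lerDl mulr_ge0// ltW.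
have y0 d : 0 < y d by rewrite (lt_le_trans ltr01).
pose eta d := (y d `^ s)^-1.
have eta0 d : 0 < eta d by rewrite invr_gt0 powR_gt0.
have sum_eta n (i : 'I_n) : \sum_(b < n) eta (dst b i) <= 4 / ep.
  apply: le_trans (sum_dst_le i (f := eta) _) _; first by move=> d; exact: ltW.
  have -> : 4 / ep = 2 * (ep^-1 + ep^-1) by ring.
  rewrite ler_pM2l//.
  have step : 1 + ep^-1 <= ep^-1 + ep^-1 by rewrite lerD2r invf_ge1.
  apply: le_trans step; apply: le_trans (sum_inv_sqr_affine n ep0).
  apply: ler_sum => d _.
  rewrite -/(y d) lef_pV2 ?posrE ?powR_gt0 ?exprn_gt0 ?y0//.
  by rewrite -powR_mulrn ?(ltW (y0 d))//; apply: ler_powR; rewrite ?y1// ltW.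
have c00 : 0 < 3 / delta * (ep `^ s)^-1.
  by rewrite mulr_gt0 ?divr_gt0// invr_gt0 powR_gt0.
exists (3 / delta * (ep `^ s)^-1) => //.
move=> n m i m0; exists (fun b => 3 / delta * eta (dst b i)).
have c3 : 0 < 3 / delta by rewrite divr_gt0.
have B_eta (a : 'I_n) : \sum_b B m a b * eta (dst b i) <= (S + 2 * delta / 3) * eta (dst a i).
  apply: (@le_trans _ _ (\sum_b (q * B m a b + K * ep `^ s * Ca * eta (dst b i)) * eta (dst a i))).
    apply: ler_sum => b _.
    have tri : y (dst a i) <= y (dst b i) + ep * (dst a b)%:R.
      rewrite /y -addrA lerD2l -mulrDr ler_pM2l// -natrD ler_nat; exact: dst_triangle.
    have H : y (dst a i) `^ s <= q * y (dst b i) `^ s + K * (ep * (dst a b)%:R) `^ s.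
      apply: le_trans (HK _ _ _ _); last 2 first.
      - exact: ltW.
      - by rewrite mulr_ge0// ltW.
      apply: ge0_ler_powR => //; rewrite ?nnegrE ?(ltW s0) ?(ltW (y0 _))//.
      by rewrite addr_ge0 ?(ltW (y0 _))// mulr_ge0// ltW.
    rewrite powRM ?(ltW ep0)// in H.
    have Ea : eta (dst a i) * y (dst a i) `^ s = 1 by rewrite mulVf// gt_eqF// powR_gt0.
    have Eb : eta (dst b i) * y (dst b i) `^ s = 1 by rewrite mulVf// gt_eqF// powR_gt0.
    have Bd := B_decay m a b.
    move: (eta0 (dst a i)) (eta0 (dst b i)) (B_ge0 m a b) (powR_ge0 ep s) H Ea Eb Bd.
    move: (eta (dst a i)) (eta (dst b i)) (y (dst a i) `^ s) (y (dst b i) `^ s).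
    move: (B m a b) (ep `^ s) ((dst a b)%:R `^ s) => Bab es dd ea eb Ya Yb.
    move=> ea0 eb0 Bab0 es0 H Ea Eb Bd.
    have -> : Bab * eb = Bab * eb * ea * Ya by rewrite -[RHS]mulrA Ea mulr1.
    have X0 : 0 <= Bab * eb * ea by rewrite !mulr_ge0// ltW.
    apply: le_trans (ler_wpM2l X0 H) _.
    have -> : Bab * eb * ea * (q * Yb + K * (es * dd)) =
        q * Bab * ea * (eb * Yb) + K * es * eb * ea * (Bab * dd) by ring.
    rewrite Eb mulr1 [leRHS](_ : _ = q * Bab * ea + K * es * eb * ea * Ca).
      by rewrite lerD2l; apply: ler_wpM2l => //; rewrite !mulr_ge0// ltW.
    by ring.
  rewrite -mulr_suml ler_wpM2r ?(ltW (eta0 _))// big_split /= -!mulr_sumr.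
  have -> : S + 2 * delta / 3 = (S + delta / 3) + delta / 3 by field.
  apply: lerD.
    apply: (@le_trans _ _ (q * S)).
      by rewrite ler_wpM2l ?B_sum// (le_trans ler01)// ltW.
    rewrite /q mulrDl mul1r lerD2l -subr_ge0.
    have -> : delta / 3 - delta / (3 * (S + 1)) * S = delta / (3 * (S + 1)).
      by field; lra.
    by rewrite divr_ge0// ltW.
  apply: (@le_trans _ _ (K * ep ^+ 2 * Ca * (4 / ep))).
    apply: ler_pM => //.
    - by rewrite !mulr_ge0 ?powR_ge0// ltW.
    - by apply: sumr_ge0 => b _; exact: ltW.
    - by rewrite ler_wpM2r// ler_wpM2l// ltW.
    - exact: sum_eta.
  have -> : K * ep ^+ 2 * Ca * (4 / ep) = 4 * (K * Ca) * ep.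
    by field; rewrite gt_eqF.
  have := mulr_ge0 (ltW K0) Ca0; nra.
have Aeta (a : 'I_n) : eta (dst a i) <=
    \sum_b interval_matrix m c a b * (3 / delta * eta (dst b i)).
  have -> : \sum_b interval_matrix m c a b * (3 / delta * eta (dst b i)) =
      3 / delta * (c 1 * eta (dst a i) - \sum_b B m a b * eta (dst b i)).
    rewrite mulrBr [in RHS](mulr_sumr) (bigD1 a) //= [in RHS](bigD1 a) //=.
    rewrite interval_matrixE// eqxx opprD addrA; congr (_ + _); first by rewrite /=; ring.
    rewrite -sumrN; apply: eq_bigr => b ba.
    by rewrite interval_matrixE// eq_sym (negbTE ba) /=; ring.
  apply: (@le_trans _ _ (3 / delta * ((delta / 3) * eta (dst a i)))).
    rewrite mulrA (_ : 3 / delta * (delta / 3) = 1) ?mul1r//.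
    by field; rewrite gt_eqF.
  rewrite ler_wpM2l ?(ltW c3)// lerBrDl (le_trans (lerD (B_eta a) (lexx _)))//.
  by rewrite -mulrDl le_eqVlt; apply/orP; left; apply/eqP; rewrite /S; field.
split.
- by move=> b; rewrite mulr_gt0.
- by move=> a; apply: lt_le_trans (Aeta a).
- apply: le_trans (Aeta i); rewrite dstnn.
  by rewrite /eta /y mulr0 addr0 powR1 invr1.
move=> b bi; rewrite -[leRHS]mulrA ler_wpM2l ?(ltW c3)// -invfM.
have d0 : (0 : R) < (dst b i)%:R.
  rewrite ltr0n; apply: dst_gt0 => /val_inj bi'.
  by move: bi; rewrite bi' eqxx.
rewrite -powRM ?(ltW ep0) ?(ltW d0)// lef_pV2 ?posrE ?powR_gt0 ?mulr_gt0//.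
apply: ge0_ler_powR; rewrite ?nnegrE ?(ltW s0) ?(ltW (y0 _)) ?mulr_ge0 ?(ltW ep0)//.
by rewrite /y lerDr.
Qed.

End supersolution.

(** * The potential *)

Section clamp.
Context (R : realType) (A B : R).

(** Precomposition with this projection turns functions controlled on [[A, B]] only into bounded
    continuous functions on the line. Being monotone, it commutes with [min] and [max], so
    log-supermodularity survives. *)
Definition clamp (x : R) : R := Num.max A (Num.min B x).

Lemma clamp_itv x : A <= B -> A <= clamp x <= B.
Proof. by move=> AB; rewrite /clamp le_max lexx ge_max AB ge_min lexx. Qed.

Lemma clamp_id x : A <= x <= B -> clamp x = x.
Proof. by move=> /andP[Ax xB]; rewrite /clamp (min_r xB) (max_r Ax). Qed.

Lemma clamp_homo : {homo clamp : x y / x <= y}.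
Proof.
by move=> x y xy; rewrite /clamp ge_max !le_max !le_min !ge_min !lexx xy /= ?orbT.
Qed.

Lemma clamp_max x y : clamp (Num.max x y) = Num.max (clamp x) (clamp y).
Proof.
have [xy|/ltW yx] := leP x y; first by rewrite max_r// clamp_homo.
by rewrite max_l// clamp_homo.
Qed.

Lemma clamp_min x y : clamp (Num.min x y) = Num.min (clamp x) (clamp y).
Proof.
have [xy|/ltW yx] := leP x y; first by rewrite min_l// clamp_homo.
by rewrite min_r// clamp_homo.
Qed.

Lemma continuous_clamp : continuous (clamp : R -> R).
Proof.
move=> x; apply: (@continuous_max _ _ (fun=> A : R^o) (fun x => Num.min B x : R^o)).
  exact: cst_continuous.
apply: (@continuous_min _ _ (fun=> B : R^o) (fun x => x : R^o)).
  exact: cst_continuous.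
by [].
Qed.

Lemma measurable_clamp : measurable_fun setT (clamp : R -> R).
Proof. by apply: continuous_measurable_fun; exact: continuous_clamp. Qed.

Hypothesis AB : A <= B.

Lemma continuous_comp_clamp (f : R -> R) :
  (forall x, A <= x <= B -> {for x, continuous f}) ->
  continuous (fun x => f (clamp x)).
Proof.
move=> cf x; apply: continuous_comp; first exact: continuous_clamp.
exact/cf/clamp_itv.
Qed.

Lemma bounded_measurable_comp_clamp (f : R -> R) :
  (forall x, A <= x <= B -> {for x, continuous f}) ->
  bounded_measurable (fun x => f (clamp x)).
Proof.
move=> cf; split; first by apply: continuous_measurable_fun; exact: continuous_comp_clamp.
have wf : {within `[A, B], continuous f}.
  by apply: continuous_in_subspaceT => x; rewrite inE/= in_itv/=; exact: cf.
have [c _ cmax] := EVT_max AB wf; have [d _ dmin] := EVT_min AB wf.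
exists (Num.max `|f c| `|f d|) => x.
have xAB : clamp x \in `[A, B] by rewrite in_itv/= clamp_itv.
have := cmax _ xAB; have := dmin _ xAB; set y := f (clamp x) => fd fc.
rewrite le_max; have [y0|y0] := leP 0 y.
  by rewrite ger0_norm// (le_trans fc (ler_norm _)).
rewrite ltr0_norm//; apply/orP; right; rewrite -normrN.
by apply: le_trans (ler_norm _); rewrite lerN2.
Qed.

End clamp.

Section calculus.
Context (R : realType).

Lemma is_derive_bigsum (J : Type) (r : seq J) (P : pred J) (f : J -> R -> R)
    (df : J -> R) (x : R) : (forall j, P j -> is_derive x 1 (f j) (df j)) ->
  is_derive x 1 (fun t => \sum_(j <- r | P j) f j t) (\sum_(j <- r | P j) df j).
Proof.
move=> H; rewrite (_ : (fun _ => _) = \sum_(j <- r | P j) f j).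
  by elim/big_ind2 : _ => // [|*]; [exact: is_derive_cst|exact: is_deriveD].
by apply/funext => t; rewrite fct_sumE.
Qed.

Lemma continuous_at_bigsum (J : Type) (r : seq J) (P : pred J) (f : J -> R -> R) (x : R) :
  (forall j, P j -> {for x, continuous (f j)}) ->
  {for x, continuous (fun t => \sum_(j <- r | P j) f j t)}.
Proof.
move=> H; elim: r => [|j r IH].
  rewrite (_ : (fun _ => _) = fun=> 0); first exact: cst_continuous.
  by apply/funext => t; rewrite big_nil.
have [Pj|nPj] := boolP (P j).
  rewrite (_ : (fun _ => _) = fun t => f j t + \sum_(j <- r | P j) f j t).
    by apply: (@cvgD _ R^o); [exact: H|exact: IH].
  by apply/funext => t; rewrite big_cons Pj.
rewrite (_ : (fun _ => _) = fun t => \sum_(j <- r | P j) f j t) //.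
by apply/funext => t; rewrite big_cons (negbTE nPj).
Qed.

End calculus.

Section potential.
Context (R : realType) (v : R -> \bar R) (r_hc z_min z_max alpha1 alpha2 s : R).
Hypothesis hv : potential_assumption v r_hc z_min z_max alpha1 alpha2 s.

Let u := fine \o v.
Let u' := derive1 u.
Let u'' := potential_d2 v.
Local Notation L := z_min.
Local Notation U := z_max.

Lemma zmin_gt0 : 0 < L.
Proof. by have [] := pa_order hv; move=> h _ _; exact: le_lt_trans (pa_rhc_ge0 hv) h. Qed.

Lemma zmin_lt_zmax : L < U.
Proof. by have [] := pa_order hv. Qed.

Let rL : r_hc < L. Proof. by have [] := pa_order hv. Qed.

Lemma is_derive_potential x : r_hc < x -> is_derive x 1 u (u' x).
Proof.
by move=> /(pa_C2 hv)[du _ _]; apply: (DeriveDef du); rewrite -derive1E.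
Qed.

Lemma is_derive_potential1 x : r_hc < x -> is_derive x 1 u' (u'' x).
Proof.
move=> /(pa_C2 hv)[_ du _]; apply: (DeriveDef du).
by rewrite -derive1E.
Qed.

Lemma continuous_potential x : r_hc < x -> {for x, continuous u}.
Proof. by move=> /is_derive_potential[? _]; apply/differentiable_continuous/derivable1_diffP. Qed.

Lemma continuous_potential1 x : r_hc < x -> {for x, continuous u'}.
Proof. by move=> /is_derive_potential1[? _]; apply/differentiable_continuous/derivable1_diffP. Qed.

Lemma potential_mvt x y : r_hc < x -> x <= y ->
  exists2 t, x <= t <= y & u y - u x = u' t * (y - x).
Proof.
move=> rx xy.
have [||t] := @MVT_segment _ u u' _ _ xy.
- by move=> t; rewrite in_itv/= => /andP[xt _]; exact/is_derive_potential/(lt_trans rx).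
- apply: continuous_in_subspaceT => t; rewrite inE/= in_itv/= => /andP[xt _].
  exact/continuous_potential/(lt_le_trans rx).
by rewrite in_itv/=; exists t.
Qed.

Lemma potential1_mvt x y : r_hc < x -> x <= y ->
  exists2 t, x <= t <= y & u' y - u' x = u'' t * (y - x).
Proof.
move=> rx xy.
have [||t] := @MVT_segment _ u' u'' _ _ xy.
- by move=> t; rewrite in_itv/= => /andP[xt _]; exact/is_derive_potential1/(lt_trans rx).
- apply: continuous_in_subspaceT => t; rewrite inE/= in_itv/= => /andP[xt _].
  exact/continuous_potential1/(lt_le_trans rx).
by rewrite in_itv/=; exists t.
Qed.

(* Lower bounds for [v''] on the range of the length of a block of [k]
   spacings. *)
Definition curvature (k : nat) : R :=
  if k == 1%N then u'' U else u'' (k%:R * L).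

Let kL k : (2 <= k)%N -> 2 * L <= k%:R * L.
Proof. by move=> k2; rewrite ler_wpM2r ?(ltW zmin_gt0)// ler_nat. Qed.

Lemma curvature_le0 k : (2 <= k)%N -> curvature k <= 0.
Proof.
move=> k2; rewrite /curvature; case: eqP => [k1|_]; first by rewrite k1 in k2.
exact/(pa_d2_npos hv)/kL.
Qed.

Lemma curvature_ge k : (2 <= k)%N ->
  - curvature k * k%:R `^ (s + 2) <= alpha2 * L `^ (- s - 2).
Proof.
move=> k2; rewrite /curvature; case: eqP => [k1|_]; first by rewrite k1 in k2.
have k0 : (0 : R) < k%:R by rewrite ltr0n (leq_trans _ k2).
have L0 := zmin_gt0.
have rk : r_hc < k%:R * L.
  apply: lt_le_trans rL _; rewrite -[leLHS]mul1r ler_wpM2r ?(ltW L0)//.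
  by rewrite ler1n (leq_trans _ k2).
have := pa_d2_lower hv rk; rewrite lerNl -/u'' => H.
apply: (@le_trans _ _ (alpha2 * (k%:R * L) `^ (- s - 2) * k%:R `^ (s + 2))).
  by rewrite ler_wpM2r ?powR_ge0.
rewrite powRM ?(ltW k0) ?(ltW L0)//.
have -> : k%:R `^ (- s - 2) = (k%:R `^ (s + 2))^-1 by rewrite -powRN; congr (_ `^ _); ring.
have K0 : 0 < k%:R `^ (s + 2) by rewrite powR_gt0.
by rewrite le_eqVlt; apply/orP; left; apply/eqP; field; rewrite gt_eqF.
Qed.

(** The terms of the series in (iv) are non-positive, so each partial sum dominates the full sum;
    [delta] is the positive quantity in (iv) itself. *)
Lemma curvature_sum : exists2 delta : R, 0 < delta &
  forall n, delta <= curvature 1 + \sum_(2 <= k < n) k%:R ^+ 2 * curvature k.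
Proof.
pose f k := k%:R ^+ 2 * u'' (k%:R * L).
have f0 k : (2 <= k)%N -> f k <= 0.
  by move=> k2; rewrite /f mulr_ge0_le0 ?exprn_ge0//; exact/(pa_d2_npos hv)/kL.
have := pa_d2_convex hv; rewrite -/u''.
set S := (\sum_(2 <= n <oo) _)%E => H.
have S0 : (S <= 0)%E.
  by apply: npeseries_le0 => n n2 _; rewrite lee_fin; exact: f0.
have Sn n : (S <= (\sum_(2 <= k < n) f k)%:E)%E.
  rewrite -sumEFin; apply: lime_le.
    by apply: is_cvg_npeseries => k k2 _; rewrite lee_fin; exact: f0.
  exists n => // N /= nN.
  have [n2|n2] := leqP 2 n; last first.
    rewrite [leRHS]big_geq ?(ltnW n2)// big_nat_cond.
    by apply: sume_le0 => k /andP[/andP[k2 _] _]; rewrite lee_fin; exact: f0.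
  rewrite [leLHS](big_cat_nat n2 nN)/=.
  rewrite geeDl// big_nat_cond.
  apply: sume_le0 => k /andP[/andP[k2 _] _]; rewrite lee_fin; apply: f0.
  exact: leq_trans n2 k2.
(* [S] is non-positive, and the value [-oo] would contradict the positivity in (iv). *)
have : S \is a fin_num.
  rewrite fin_numE; apply/andP; split; last by rewrite lt_eqF// (le_lt_trans S0).
  by apply/eqP => SE; move: H; rewrite SE.
case: S H S0 Sn => // S; rewrite -EFinD lte_fin => H S0 Sn _.
exists (u'' U + S) => // n; rewrite /curvature eqxx lerD2l.
have := Sn n; rewrite lee_fin => /le_trans; apply.
rewrite le_eqVlt; apply/orP; left; apply/eqP; apply: eq_big_nat => k /andP[k2 _].
have -> : (k == 1)%N = false by apply/eqP => k1; rewrite k1 in k2.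
by [].
Qed.

(** Mean value theorem for [v']. By (iii), [curvature k] is a lower bound for [v''] on the
    admissible lengths: it is attained at the right end for one spacing, at the left end for longer
    blocks. *)
Lemma potential1_ge k x y : (0 < k)%N -> k%:R * L <= x -> x <= y ->
  (k == 1)%N ==> (y <= U) -> curvature k * (y - x) <= u' y - u' x.
Proof.
move=> k0 kx xy k1y.
have L0 := zmin_gt0.
have rk : r_hc < k%:R * L.
  by apply: lt_le_trans rL _; rewrite -[leLHS]mul1r ler_wpM2r ?(ltW L0)// ler1n.
have [t /andP[xt ty] ->] := potential1_mvt (lt_le_trans rk kx) xy.
rewrite ler_wpM2r ?subr_ge0// /curvature.
case: eqP k1y => [k1 /= yU|/eqP k1 _].
  apply: (pa_d2_decr hv); rewrite ?(le_trans ty)//.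
  by apply: le_trans xt; move: kx; rewrite k1 mul1r.
have k2 : (2 <= k)%N by rewrite ltn_neqAle eq_sym k1.
by apply: (pa_d2_incr hv); [exact: kL|exact: le_trans xt].
Qed.

(** Beyond [2 * z_min] the potential is concave, so spreading two lengths apart with fixed sum
    lowers the total. *)
Lemma potential_submodular (a b lo hi : R) : 2 * L <= lo -> lo <= a -> lo <= b ->
  lo + hi = a + b -> u lo + u hi <= u a + u b.
Proof.
move=> Llo; have L0 := zmin_gt0.
have r2 : r_hc < 2 * L by apply: lt_trans rL _; lra.
wlog ab : a b / a <= b => [wlg|].
  have [ab|/ltW ba] := leP a b; first exact: wlg.
  by move=> la lb E; rewrite [leRHS]addrC; apply: wlg; rewrite // E addrC.
move=> la lb E.
have rlo := lt_le_trans r2 Llo.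
have bhi : b <= hi by lra.
have [t1 /andP[lt1 t1a] E1] := potential_mvt rlo la.
have [t2 /andP[bt2 t2hi] E2] := potential_mvt (lt_le_trans rlo lb) bhi.
have t12 : t1 <= t2 by lra.
have [t3 /andP[t13 _] E3] := potential1_mvt (lt_le_trans rlo lt1) t12.
have d0 : u' t2 - u' t1 <= 0.
  rewrite E3 mulr_le0_ge0 ?subr_ge0//; apply: (pa_d2_npos hv).
  exact: le_trans Llo (le_trans lt1 t13).
have := mulr_ge0_le0 (_ : 0 <= a - lo) d0; rewrite subr_ge0 => /(_ la).
have Ed : hi - b = a - lo by lra.
rewrite Ed in E2; nra.
Qed.

End potential.

(** * Finite chains *)

Section segments.
Context (R : realType) (n : nat).

(** Written with indicators over all sites, the block length is visibly linear in [y], and its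
    derivative in [y a] is the indicator of [i <= a < j]. *)
Definition seg (y : 'I_n -> R) (i j : nat) : R :=
  \sum_(b < n) (i <= b < j)%N%:R * y b.

Lemma seg_nat (y : nat -> R) i j : (i <= j <= n)%N ->
  seg (fun b => y b) i j = \sum_(i <= l < j) y l.
Proof.
move=> /andP[ij jn].
rewrite /seg -(big_mkord xpredT (fun b => (i <= b < j)%N%:R * y b)).
rewrite (big_cat_nat (leq0n i) (leq_trans ij jn)) /=.
rewrite [X in X + _]big_nat_cond [X in X + _]big1 ?add0r => [|b]; last first.
  by move=> /andP[/andP[_ bi] _]; rewrite leqNgt bi mul0r.
rewrite (big_cat_nat ij jn) /= [X in _ + X]big_nat_cond [X in _ + X]big1 ?addr0 => [|b]; last first.
  by move=> /andP[/andP[jb _] _]; rewrite ltnNge jb andbF mul0r.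
by apply: eq_big_nat => b ->; rewrite mul1r.
Qed.

Lemma seg_cst (c : R) i j : (i <= j <= n)%N -> seg (fun=> c) i j = (j - i)%:R * c.
Proof. by move=> ij; rewrite (seg_nat (fun=> c))// sumr_const_nat mulr_natl. Qed.

Lemma seg1 (y : 'I_n -> R) (b : 'I_n) : seg y b b.+1 = y b.
Proof.
rewrite /seg (bigD1 b) //= leqnn ltnSn mul1r big1 ?addr0// => a ab.
rewrite (_ : (b <= a < b.+1)%N = false) ?mul0r//; apply/negP => /andP[h1 h2].
by move/negP: ab; apply; apply/eqP/val_inj/eqP; rewrite eqn_leq h1 -ltnS h2.
Qed.

Lemma ler_seg (x y : 'I_n -> R) i j : (forall b, x b <= y b) -> seg x i j <= seg y i j.
Proof. by move=> xy; apply: ler_sum => b _; rewrite ler_wpM2l. Qed.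

Lemma segD (x y : 'I_n -> R) i j : seg y i j + seg x i j = seg (fun b => y b + x b) i j.
Proof. by rewrite -big_split; apply: eq_bigr => b _; rewrite mulrDr. Qed.

Lemma seg_itv (x : 'I_n -> R) (A B : R) i j : (i <= j <= n)%N ->
  (forall b, A <= x b <= B) -> (j - i)%:R * A <= seg x i j <= (j - i)%:R * B.
Proof.
move=> ij xAB; rewrite -!seg_cst//.
by apply/andP; split; apply: ler_seg => b; have /andP[] := xAB b.
Qed.

(** Brings the product of matrix and vector into the blockwise form of the force, so that the two
    can be compared term by term. *)
Lemma interval_matrix_seg m (c : nat -> R) (a : 'I_n) (y : 'I_n -> R) :
  \sum_b interval_matrix m c a b * y b =
  interval_sum n m (fun i j => (i <= a < j)%N%:R * (c (j - i)%N * seg y i j)).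
Proof.
rewrite (eq_bigr (fun b => interval_sum n m (fun i j =>
    y b * ((i <= a < j)%N%:R * (i <= b < j)%N%:R * c (j - i)%N)))); last first.
  by move=> b _; rewrite interval_sumZ mulrC.
rewrite interval_sum_sum; apply: eq_interval_sum => i j _ _.
by rewrite /seg !mulr_sumr; apply: eq_bigr => b _; ring.
Qed.

Lemma interval_sumD m (f g : nat -> nat -> R) :
  interval_sum n m (fun i j => f i j + g i j) = interval_sum n m f + interval_sum n m g.
Proof. by rewrite -big_split; apply: eq_bigr => i _; rewrite -big_split. Qed.

End segments.

Section finite_volume.
Context (R : realType) (v : R -> \bar R) (r_hc z_min z_max alpha1 alpha2 s : R).
Hypothesis hv : potential_assumption v r_hc z_min z_max alpha1 alpha2 s.
Context (m : option nat) (beta p : R) (n : nat).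
Hypothesis beta_gt0 : 0 < beta.

Let u := fine \o v.
Let u' := derive1 u.
Local Notation L := z_min.
Local Notation U := z_max.
Let LU : L < U := zmin_lt_zmax hv.
Let L0 : 0 < L := zmin_gt0 hv.
Let rL : r_hc < L. Proof. by have [] := pa_order hv. Qed.

Definition chain_energy (y : 'I_n -> R) : R :=
  interval_sum n m (fun i j => u (seg y i j)) + p * \sum_b y b.

Definition chain_force (a : 'I_n) (y : 'I_n -> R) : R :=
  interval_sum n m (fun i j => (i <= a < j)%N%:R * u' (seg y i j)) + p.

Definition clamped (z : n.-tuple R) (b : 'I_n) : R := clamp L U (tnth z b).

(** Equal to the Boltzmann weight on the box. Clamping extends it to all tuples without ever
    evaluating the potential in the hard core. *)
Definition weight (z : n.-tuple R) : R := expR (- (beta * chain_energy (clamped z))).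

Lemma clamped_itv z b : L <= clamped z b <= U.
Proof. exact/clamp_itv/ltW. Qed.

Lemma measurable_clamped b : measurable_fun setT (fun z => clamped z b).
Proof.
apply: (measurableT_comp (measurable_clamp L U)); exact: measurable_tnth.
Qed.

Lemma bounded_measurable_clamped b : bounded_measurable (fun z => clamped z b).
Proof.
have H := @bounded_measurable_comp_clamp R L U (ltW LU) id (fun x _ => @cvg_id _ _).
exact: (bounded_measurable_comp H (measurable_tnth b)).
Qed.

Let seg_clamped z i j : (i < j <= n)%N ->
  (j - i)%:R * L <= seg (clamped z) i j <= (j - i)%:R * U.
Proof.
move=> /andP[ij jn]; apply: seg_itv; first by rewrite (ltnW ij).
by move=> b; exact: clamped_itv.
Qed.

Let seg_clamped_LnU z i j : (i < j <= n)%N ->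
  L <= seg (clamped z) i j <= n%:R * U.
Proof.
move=> ijn; have /andP[h1 h2] := seg_clamped z ijn; move: ijn => /andP[ij jn].
apply/andP; split.
  apply: le_trans h1; rewrite -[leLHS]mul1r ler_wpM2r ?(ltW L0)// ler1n.
  by rewrite subn_gt0.
apply: le_trans h2 _; rewrite ler_wpM2r ?(le_trans (ltW L0) (ltW LU))// ler_nat.
by rewrite (leq_trans (leq_subr _ _)).
Qed.

Let bounded_measurable_seg (f : R -> R) i j : (i < j <= n)%N ->
  (forall x, r_hc < x -> {for x, continuous f}) ->
  bounded_measurable (fun z => f (seg (clamped z) i j)).
Proof.
move=> ijn cf.
have LnU : L <= n%:R * U.
  have := seg_clamped_LnU [tuple of nseq n 0] ijn => /andP[h1 h2].
  exact: le_trans h1 h2.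
have H : bounded_measurable (fun x => f (clamp L (n%:R * U) x)).
  apply: bounded_measurable_comp_clamp => // x /andP[Lx _].
  exact/cf/(lt_le_trans rL).
(* Block lengths lie in [[L, n * U]], so this outer clamp changes nothing; it makes [f], continuous
   only beyond [r_hc], continuous and bounded on the line. *)
rewrite (_ : (fun _ => _) =
    fun z => f (clamp L (n%:R * U) (seg (clamped z) i j))); last first.
  by apply/funext => z; rewrite clamp_id// seg_clamped_LnU.
apply: (bounded_measurable_comp H).
apply: measurable_sum => b; apply: measurable_funM; first exact: measurable_cst.
exact: measurable_clamped.
Qed.

Let bounded_measurable_interval_sum (f : nat -> nat -> n.-tuple R -> R) :
  (forall i j, (i < j <= n)%N -> bounded_measurable (f i j)) ->
  bounded_measurable (fun z => interval_sum n m (fun i j => f i j z)).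
Proof.
move=> bf; apply: bounded_measurable_sum => i _.
apply: bounded_measurable_sum => j /andP[ij _].
by apply: bf; rewrite ij -ltnS ltn_ord.
Qed.

Lemma bounded_measurable_chain_energy :
  bounded_measurable (fun z => chain_energy (clamped z)).
Proof.
apply: bounded_measurableD.
  apply: bounded_measurable_interval_sum => i j ijn.
  apply: bounded_measurable_seg => // x; exact: (continuous_potential hv).
apply: bounded_measurableZ; apply: bounded_measurable_sum => b _.
exact: bounded_measurable_clamped.
Qed.

Lemma bounded_measurable_chain_force a :
  bounded_measurable (fun z => chain_force a (clamped z)).
Proof.
apply: bounded_measurableD; last exact: bounded_measurable_cst.
apply: bounded_measurable_interval_sum => i j ijn.
apply: bounded_measurableZ; apply: bounded_measurable_seg => // x.
exact: (continuous_potential1 hv).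
Qed.

Lemma weight_ge : exists2 w0 : R, 0 < w0 & forall z, w0 <= weight z.
Proof.
have [_ [M HM]] := bounded_measurable_chain_energy.
exists (expR (- (beta * M))); first exact: expR_gt0.
move=> z; rewrite ler_expR lerN2 ler_pM2l//.
exact: le_trans (ler_norm _) (HM z).
Qed.

Lemma bounded_measurable_weight : bounded_measurable weight.
Proof.
have [mE [M HM]] := bounded_measurable_chain_energy; split.
  apply: (measurableT_comp (@measurable_expR R)).
  have [] := bounded_measurableN (bounded_measurableZ beta
    bounded_measurable_chain_energy).
  by [].
exists (expR (beta * M)) => z; rewrite ger0_norm ?expR_ge0// ler_expR -mulrN.
rewrite ler_pM2l//; apply: le_trans (HM z).
by rewrite -normrN ler_norm.
Qed.

(** Compared block by block. For at least two spacings, meet and join preserve the sum of the two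
    block lengths and spread them apart, so concavity decides. For a single spacing they merely
    permute the two values. *)
Lemma weight_lsm z1 z2 lo hi : is_meet_join z1 z2 lo hi ->
  weight z1 * weight z2 <= weight hi * weight lo.
Proof.
move=> mj; rewrite -!expRD ler_expR -!opprD lerN2 -!mulrDr ler_pM2l//.
have Elo b : clamped lo b = Num.min (clamped z1 b) (clamped z2 b).
  by rewrite /clamped; have [-> _] := mj b; rewrite clamp_min.
have Ehi b : clamped hi b = Num.max (clamped z1 b) (clamped z2 b).
  by rewrite /clamped; have [_ ->] := mj b; rewrite clamp_max.
have Esum b : clamped hi b + clamped lo b = clamped z1 b + clamped z2 b.
  by rewrite Elo Ehi addr_max_min.
rewrite /chain_energy addrACA [leRHS]addrACA.
apply: lerD; last first.
  rewrite -!mulrDr -!big_split /=.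
  by rewrite (eq_bigr (fun b => clamped z1 b + clamped z2 b)).
rewrite -!interval_sumD; apply: ler_interval_sum => i j ijn _.
have [ij2|ij1] := leqP 2 (j - i).
  rewrite [leLHS]addrC; apply: (potential_submodular hv).
  - have /andP[h _] := seg_clamped lo ijn; apply: le_trans h.
    by rewrite ler_wpM2r ?(ltW L0)// ler_nat.
  - by apply: ler_seg => b; rewrite Elo ge_min lexx.
  - by apply: ler_seg => b; rewrite Elo ge_min lexx orbT.
  - by rewrite !segD; apply: eq_bigr => b _; rewrite -Esum [in RHS]addrC.
have iltn : (i < n)%N by lia.
have -> : j = (Ordinal iltn).+1 by rewrite /=; lia.
rewrite -[i]/(nat_of_ord (Ordinal iltn)) !seg1 Elo Ehi.
have [_|_] := leP (clamped z1 (Ordinal iltn)) (clamped z2 (Ordinal iltn)).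
  by rewrite [leLHS]addrC.
exact: lexx.
Qed.

Lemma clamped_upd a t z b : L <= t <= U ->
  clamped (upd a t z) b = if b == a then t else clamped z b.
Proof. by move=> tI; rewrite /clamped tnth_upd; case: eqP => // _; rewrite clamp_id. Qed.

Let continuous_clamped_upd a z b : continuous (fun t => clamped (upd a t z) b).
Proof.
have [->|ba] := eqVneq b a.
  rewrite (_ : (fun _ => _) = clamp L U); first exact: continuous_clamp.
  by apply/funext => t; rewrite /clamped tnth_upd eqxx.
rewrite (_ : (fun _ => _) = fun=> clamped z b); first exact: cst_continuous.
by apply/funext => t; rewrite /clamped tnth_upd (negbTE ba).
Qed.

Lemma weight_derive a z : exists k : R -> R,
  [/\ forall t, L <= t <= U -> weight (upd a t z) = k t,
      {within `[L, U], continuous (fun t => beta * chain_force a (clamped (upd a t z)))}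
    & forall t, L <= t <= U -> is_derive t 1 k
        (- (beta * chain_force a (clamped (upd a t z)) * k t))].
Proof.
(* The coordinate [a] is left unclamped: the resulting weight is differentiable also at the ends of
   [[L, U]], where [clamp] has kinks. *)
pose y (t : R) (b : 'I_n) := if b == a then t else clamped z b.
have yE t : L <= t <= U -> clamped (upd a t z) = y t.
  by move=> tI; apply/funext => b; rewrite clamped_upd.
exists (fun t => expR (- (beta * chain_energy (y t)))); split.
- by move=> t tI; rewrite /weight yE.
- apply: continuous_subspaceT => t.
  apply: (@cvgM _ R); first exact: cst_continuous.
  apply: (@cvgD _ R^o); last exact: cst_continuous.
  apply: continuous_at_bigsum => i _; apply: continuous_at_bigsum => j /andP[ij _].
  have ijn : (i < j <= n)%N by rewrite ij -ltnS ltn_ord.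
  apply: (@cvgM _ R); first exact: cst_continuous.
  apply: (@continuous_comp _ _ _ (fun t => seg (clamped (upd a t z)) i j) u').
    apply: continuous_at_bigsum => b _; apply: (@cvgM _ R); first exact: cst_continuous.
    exact: continuous_clamped_upd.
  apply: (continuous_potential1 hv); apply: lt_le_trans rL _.
  by have /andP[] := seg_clamped_LnU (upd a t z) ijn.
move=> t tI; rewrite yE//.
have dy b : is_derive t 1 (y ^~ b) (b == a)%:R.
  rewrite /y; case: (b == a); first exact: is_derive_id.
  exact: is_derive_cst.
have dseg i j : is_derive t 1 (fun t => seg (y t) i j) (i <= a < j)%N%:R.
  have -> : (i <= a < j)%N%:R = \sum_(b < n) (i <= b < j)%N%:R * (b == a)%:R :> R.
    by rewrite (bigD1 a)//= eqxx mulr1 big1 ?addr0// => b /negbTE ->; rewrite mulr0.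
  by apply: is_derive_bigsum => b _; exact: is_deriveZ.
have dE : is_derive t 1 (fun t => chain_energy (y t)) (chain_force a (y t)).
  apply: is_deriveD.
    apply: is_derive_bigsum => i _; apply: is_derive_bigsum => j /andP[ij _].
    have ijn : (i < j <= n)%N by rewrite ij -ltnS ltn_ord.
    have Hu : is_derive (seg (y t) i j) 1 u (u' (seg (y t) i j)).
      apply: (is_derive_potential hv); apply: lt_le_trans rL _.
      by rewrite -yE//; have /andP[] := seg_clamped_LnU (upd a t z) ijn.
    have D := @is_derive1_comp _ u (fun t => seg (y t) i j) t _ _ Hu (dseg i j).
    by apply: is_derive_eq D _; rewrite mulrC.
  have D : is_derive t 1 (fun t => \sum_(b < n) y t b) (\sum_(b < n) (b == a)%:R).
    by apply: is_derive_bigsum => b _; exact: dy.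
  apply: is_derive_eq (is_deriveZ p D) _.
  rewrite (bigD1 a)//= eqxx big1 ?addr0; first by rewrite [LHS]mulr1.
  by move=> b /negbTE ->.
have := @is_derive1_comp _ expR (fun t => - (beta * chain_energy (y t))) t
  _ _ (is_derive_expR _) (is_deriveN (is_deriveZ beta dE)).
by rewrite mulrC mulNr.
Qed.

(** Each block through [a] contributes [v'] of its length minus [curvature] times its length,
    nondecreasing because [curvature] bounds [v''] from below on the possible lengths. *)
Lemma chain_force_nondecreasing a : coord_nondecreasing (fun z =>
  chain_force a (clamped z)
  - \sum_b interval_matrix m (curvature v z_min z_max) a b * clamped z b).
Proof.
move=> z1 z2 z12; rewrite !interval_matrix_seg /chain_force.
rewrite ![_ + p - _]addrAC lerD2r -!interval_sumB.
apply: ler_interval_sum => i j ijn _.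
rewrite -!mulrBr ler_wpM2l//.
have c12 b : clamped z1 b <= clamped z2 b by exact: clamp_homo.
rewrite -[leRHS]addr0 -[leLHS]addr0 -subr_ge0.
have := @potential1_ge _ _ _ _ _ _ _ _ hv (j - i) (seg (clamped z1) i j) (seg (clamped z2) i j).
move: (ijn) => /andP[ij jn]; rewrite subn_gt0 => /(_ ij).
have /andP[h1 _] := seg_clamped z1 ijn; move=> /(_ h1).
move=> /(_ (ler_seg _ _ c12)) H.
have : (j - i == 1)%N ==> (seg (clamped z2) i j <= U).
  apply/implyP => /eqP ji1; have /andP[_] := seg_clamped z2 ijn.
  by rewrite ji1 mul1r.
move=> /H; rewrite -/u -/u'; lra.
Qed.

Local Notation C := (wcov L U weight).
Local Notation I := (box_int L U).

Lemma wcov_chain_force_le (a i : 'I_n) (psi : R -> R) :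
  bounded_measurable psi -> continuous psi -> (forall x, 0 <= psi x) ->
  C (fun z => prim L U psi (clamped z i)) (fun z => beta * chain_force a (clamped z))
  <= (a == i)%:R * (I weight * I (fun z => psi (clamped z i) * weight z)).
Proof.
move=> bpsi cpsi psi0.
have [w0 w00 Ww0] := weight_ge.
have bF : bounded_measurable (fun z => beta * chain_force a (clamped z)).
  exact/bounded_measurableZ/bounded_measurable_chain_force.
have bprim := bounded_measurable_comp (bounded_measurable_prim L U bpsi) (measurable_clamped i).
have bW := bounded_measurable_weight.
have [ai|ai] := eqVneq a i; rewrite ?mul1r ?mul0r.
  have [dP Pf] := prim_continuous LU cpsi.
  set P := fun x => parameterized_integral _ _ x psi in dP Pf.
  have PE : (fun z => P (clamped z i)) = (fun z => prim L U psi (clamped z i)).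
    apply/funext => z; rewrite primE//.
    by have /andP[] := clamped_itv z i.
  rewrite -PE -ai.
  have H := wcov_log_derive_coord (P := P) (f := psi) (c := clamp L U)
    LU bW bF w00 Ww0 (weight_derive a).
  apply: H.
  - by move=> x; exact/clamp_itv/ltW.
  - by move=> x; exact: clamp_id.
  - by rewrite -ai in PE bprim; rewrite [X in bounded_measurable X]PE.
  - rewrite ai; exact: (bounded_measurable_comp bpsi (measurable_clamped i)).
  - exact: continuous_subspaceT.
  - exact: dP.
  - exact: Pf.
  - move=> x /andP[Lx xU]; rewrite /P -!(@primE _ L U) ?(ltW LU)//.
    by rewrite !prim_ge0_homo.
apply: (wcov_log_derive_le0 LU bW bF w00 Ww0 weight_lsm (weight_derive a)) => //.
- by move=> x z; rewrite /clamped tnth_upd eq_sym (negbTE ai).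
- move=> z1 z2 z12; apply: prim_ge0_homo => //; exact: clamp_homo.
Qed.

Lemma wcov_coord_le (i : 'I_n) (psi : R -> R) (h : 'I_n -> R) :
  m <> Some 0%N ->
  bounded_measurable psi -> continuous psi -> (forall x, 0 <= psi x) ->
  let A := interval_matrix m (curvature v z_min z_max) in
  (forall b, 0 < h b) -> (forall a, 0 < \sum_b A a b * h b) ->
  1 <= \sum_b A i b * h b -> (forall a b, a != b -> A a b <= 0) ->
  forall b, C (fun z => prim L U psi (clamped z i)) (fun z => clamped z b) <=
    beta^-1 * (I weight * I (fun z => psi (clamped z i) * weight z)) * h b.
Proof.
move=> m0 bpsi cpsi psi0 A h0 Ah0 Ahi A_le0.
have bprim := bounded_measurable_comp (bounded_measurable_prim L U bpsi) (measurable_clamped i).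
have bW := bounded_measurable_weight.
have W0 z : 0 <= weight z by exact: expR_ge0.
set M := I weight * _.
have M0 : 0 <= M.
  by apply: mulr_ge0; apply: box_int_ge0 => z _ //; rewrite mulr_ge0.
apply: (max_principle A_le0 h0 Ah0) => a.
set F := fun z => prim L U psi (clamped z i) in bprim *.
have bl : bounded_measurable (fun z => \sum_b A a b * clamped z b).
  apply: bounded_measurable_sum => b _; apply: bounded_measurableZ.
  exact: bounded_measurable_clamped.
have bf := bounded_measurable_chain_force a.
have : 0 <= C F (fun z => chain_force a (clamped z) - \sum_b A a b * clamped z b).
  apply: fkg => //.
  - exact: weight_lsm.
  - exact: bounded_measurableB.
  - by move=> z1 z2 z12; apply: prim_ge0_homo => //; exact: clamp_homo.
  - exact: chain_force_nondecreasing.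
rewrite wcovB// subr_ge0 wcov_sum//; last first.
  by move=> b _; apply: bounded_measurableZ; exact: bounded_measurable_clamped.
rewrite (eq_bigr (fun b => A a b * C F (fun z => clamped z b))); last first.
  by move=> b _; rewrite wcovZ//; exact: bounded_measurable_clamped.
move=> /le_trans; apply.
have := wcov_chain_force_le a i bpsi cpsi psi0; rewrite -/F wcovZ// -/M => H.
rewrite -(ler_pM2l beta_gt0); apply: le_trans H _.
rewrite -[beta^-1 * M * _]mulrA mulVKf; last by rewrite gt_eqF.
(* In row [i] the normalisation [1 <= (A h)_i] absorbs the source; in the other rows the source
   vanishes and positivity of [(A h)_a] is enough. *)
have [->|ai] := eqVneq a i; first by rewrite mul1r ler_peMr.
by rewrite mul0r mulr_ge0// ltW.
Qed.

End finite_volume.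

(** * The covariance bound for finite chains, uniform in their length *)

Section covariance_bound.
Context (R : realType) (v : R -> \bar R) (r_hc z_min z_max alpha1 alpha2 s : R).
Hypothesis hv : potential_assumption v r_hc z_min z_max alpha1 alpha2 s.
Local Notation L := z_min.
Local Notation U := z_max.
Local Notation I := (box_int L U).

Lemma prim_derive1 (f : R -> R) :
  (forall x, L <= x <= U -> derivable f x 1) ->
  (forall x, L <= x <= U -> {for x, continuous (derive1 f)}) ->
  forall x, L <= x <= U ->
  prim L U (fun t => derive1 f (clamp L U t)) x = f x - f L.
Proof.
move=> df cf x /andP[Lx xU]; rewrite primE//.
have [xL|Lx'] := leP x L.
  have -> : x = L by apply/le_anti; rewrite xL.
  by rewrite subrr /parameterized_integral set_itv1 Rintegral_set1.
have sub t : L <= t <= x -> L <= t <= U.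
  by move=> /andP[-> tx]; rewrite (le_trans tx xU).
have cf1 t : L <= t <= x -> {for t, continuous f}.
  by move=> /sub/df ?; apply/differentiable_continuous/derivable1_diffP.
have LL : L <= L <= x by rewrite lexx Lx.
have Lxx : L <= x <= x by rewrite lexx Lx.
have H : derivable_oo_LRcontinuous f L x.
  split.
  - by move=> t; rewrite in_itv/= => /andP[/ltW Lt /ltW tx]; apply/df/sub; rewrite Lt.
  - by apply/cvg_at_right_filter; exact: cf1.
  - by apply/cvg_at_left_filter; exact: cf1.
rewrite /parameterized_integral /Rintegral (@continuous_FTC2 _ _ f)//.
- apply: continuous_subspaceT => t.
  by apply: (continuous_comp_clamp (ltW (zmin_lt_zmax hv)) (f := derive1 f)).
- move=> t; rewrite in_itv/= => /andP[/ltW Lt /ltW tx].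
  by rewrite clamp_id//; apply: sub; rewrite Lt.
Qed.

(** On the box every block has length at least [z_min > r_hc], so the potential is finite and [fine]
    loses nothing. *)
Lemma energyE m p n (z : n.-tuple R) : box L U z ->
  energy v m p (N := n.+1) z = (chain_energy v m p (clamped L U z))%:E.
Proof.
move=> zb.
have cE b : clamped L U z b = z`_b.
  by rewrite /clamped (tnth_nth 0) clamp_id//; have := zb b; rewrite (tnth_nth 0).
have cF : clamped L U z = fun b : 'I_n => z`_b by apply/funext.
rewrite /energy /chain_energy EFinD; congr (_ + _)%E; last first.
  by congr (_ * _)%:E; apply: eq_bigr => b _; rewrite cE.
rewrite /interval_sum -sumEFin; apply: eq_bigr => i _.
rewrite -sumEFin; apply: eq_bigr => j /andP[ij _].
have ijn : (i <= j <= n)%N by rewrite (ltnW ij) -ltnS ltn_ord.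
rewrite cF seg_nat// /= fineK//; apply: (pa_finite hv).
rewrite -(seg_nat (fun l => z`_l) ijn).
have [] := pa_order hv => rL _ _; apply: lt_le_trans rL _.
have L0 := zmin_gt0 hv.
have /andP[h _] : (j - i)%:R * L <= seg (fun b : 'I_n => z`_b) i j <= (j - i)%:R * U.
  by apply: seg_itv => // b; have := zb b; rewrite (tnth_nth 0).
apply: le_trans h; rewrite -[leLHS]mul1r ler_wpM2r ?(ltW L0)// ler1n.
by rewrite subn_gt0.
Qed.

Lemma gibbs_meanE m beta p n (F : n.-tuple R -> R) :
  gibbs_mean v m L U beta p (N := n.+1) F =
  I (fun z => F z * weight v L U m beta p z) / I (weight v L U m beta p (n := n)).
Proof.
have bE z : box L U z -> boltzmann v m beta p (N := n.+1) z = weight v L U m beta p z.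
  by move=> zb; rewrite /boltzmann energyE// -EFinM.
by congr (_ / _); apply: eq_box_int => z zb; rewrite bE.
Qed.

(** The constant is that of the supersolution, built from [delta], [alpha2], [z_min], [s] and
    [curvature] before [m], [beta], [p] and [n] are introduced. *)
Lemma gibbs_cov_le : exists2 c : R, 0 < c &
  forall m beta p n (i j : 'I_n) (f g : R -> R), m <> Some 0%N -> 0 < beta -> i != j ->
  (forall x, L <= x <= U -> derivable f x 1) ->
  (forall x, L <= x <= U -> {for x, continuous (derive1 f)}) ->
  (forall x, L <= x <= U -> derivable g x 1) ->
  (forall x, L <= x <= U -> {for x, continuous (derive1 g)}) ->
  let E := gibbs_mean v m L U beta p (N := n.+1) in
  `|E (fun z => f (tnth z i) * g (tnth z j))
    - E (fun z => f (tnth z i)) * E (fun z => g (tnth z j))|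
  <= c / (beta * (dst i j)%:R `^ s)
     * Num.sqrt (E (fun z => derive1 f (tnth z i) ^+ 2) * E (fun z => derive1 g (tnth z j) ^+ 2)).
Proof.
have [delta delta0 Hdelta] := curvature_sum hv.
have Ca0 : 0 <= alpha2 * L `^ (- s - 2) by rewrite mulr_ge0 ?powR_ge0// ltW ?(pa_alpha2 hv).
have [c0 c00 Hc0] := interval_matrix_supersolution (pa_s hv) delta0 Ca0
  (curvature_le0 hv) (curvature_ge hv) Hdelta.
exists c0 => // m beta p n i j f g m0 beta0 ij df cf dg cg; lazy zeta.
set E := gibbs_mean v m L U beta p (N := n.+1).
have LU := zmin_lt_zmax hv.
pose W := weight v L U m beta p (n := n).
pose A := interval_matrix (n := n) m (curvature v L U).
have A_le0 a b : a != b -> A a b <= 0.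
  move=> ab; apply: sumr_le0 => k _; apply: sumr_le0 => l _.
  case: (boolP (k <= a < l)%N) => ka; last by rewrite !mul0r.
  case: (boolP (k <= b < l)%N) => kb; last by rewrite mulr0 mul0r.
  rewrite !mul1r; apply: (curvature_le0 hv).
  have nab : nat_of_ord a <> nat_of_ord b by move=> /val_inj/eqP; apply/negP.
  by move: ka kb => /andP[k1 k2] /andP[k3 k4]; clear -nab k1 k2 k3 k4; lia.
have dC : dst j i = dst i j by rewrite /dst addnC.
have d0 : (0 : R) < (dst i j)%:R.
  by rewrite ltr0n; apply: dst_gt0 => /val_inj/eqP; exact/negP.
have ds0 : 0 < (dst i j)%:R `^ s by rewrite powR_gt0.
have W0 z : 0 <= W z by exact: expR_ge0.
have bW : bounded_measurable W := bounded_measurable_weight hv m p n beta0.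
have IW0 : 0 <= I W by apply: box_int_ge0.
pose phi t := derive1 f (clamp L U t); pose gamma t := derive1 g (clamp L U t).
have bphi : bounded_measurable phi := bounded_measurable_comp_clamp (ltW LU) cf.
have bgamma : bounded_measurable gamma := bounded_measurable_comp_clamp (ltW LU) cg.
have cphi : continuous phi := continuous_comp_clamp (ltW LU) cf.
have cgamma : continuous gamma := continuous_comp_clamp (ltW LU) cg.
(* [wcov] exceeds the true covariance by [(I W) ^+ 2]: one factor is put here, the other sits in the
   square root of two unnormalised integrals. *)
pose kappa := c0 / (beta * (dst i j)%:R `^ s) * I W.
have kappa0 : 0 <= kappa by rewrite mulr_ge0// divr_ge0 ?mulr_ge0 ?ltW.
have main : `|wcov L U W (fun z => prim L U phi (clamped L U z i))
      (fun z => prim L U gamma (clamped L U z j))|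
    <= kappa * Num.sqrt (I (fun z => phi (clamped L U z i) ^+ 2 * W z) *
                         I (fun z => gamma (clamped L U z j) ^+ 2 * W z)).
  apply: (wcov_prim_sqrt bW W0 (weight_lsm hv m p beta0) (measurable_clamp L U)
    (@clamp_homo _ L U) (fun x => clamp_itv x (ltW LU)) kappa0 bphi bgamma cphi cgamma).
  move=> d e de psi bpsi cpsi psi0.
  have [h [h0 Ah0 Ahd hd]] := Hc0 n m d m0.
  have H := wcov_coord_le hv p beta0 m0 bpsi cpsi psi0 h0 Ah0 Ahd A_le0 e.
  apply: le_trans H _; rewrite -/W /kappa.
  have he : h e <= c0 / (dst i j)%:R `^ s.
    case: de => [[Ed Ee]|[Ed Ee]]; rewrite Ed Ee in hd *.
      by rewrite -dC; apply: hd; rewrite eq_sym.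
    exact: hd.
  have X0 : 0 <= I W * I (fun z => psi (clamp L U (tnth z d)) * W z).
    by apply: mulr_ge0 => //; apply: box_int_ge0 => z _; rewrite mulr_ge0.
  apply: (@le_trans _ _ (beta^-1 * (I W * I (fun z => psi (clamp L U (tnth z d)) * W z))
      * (c0 / (dst i j)%:R `^ s))).
    by rewrite ler_wpM2l// mulr_ge0// invr_ge0 ltW.
  by rewrite le_eqVlt; apply/orP; left; apply/eqP; field; rewrite !gt_eqF.
have bI := bounded_measurable_clamped hv.
have covE : wcov L U W (fun z => f (tnth z i)) (fun z => g (tnth z j)) =
    wcov L U W (fun z => prim L U phi (clamped L U z i))
      (fun z => prim L U gamma (clamped L U z j)).
  have bp a psi (bpsi : bounded_measurable psi) :
      bounded_measurable (fun z : n.-tuple R => prim L U psi (clamped L U z a)).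
    exact: (bounded_measurable_comp (bounded_measurable_prim L U bpsi) (measurable_clamped L U a)).
  have bc (c : R) := bounded_measurable_cst (n.-tuple R) c.
  (* On the box [f] is the primitive of its clamped derivative plus the constant [f L], to which
     covariances are blind. *)
  transitivity (wcov L U W (fun z => prim L U phi (clamped L U z i) + f L)
      (fun z => prim L U gamma (clamped L U z j) + g L)).
    apply: eq_wcov => z zb.
      by rewrite prim_derive1 ?subrK ?(clamped_itv hv)// /clamped clamp_id//; exact: zb.
    by rewrite prim_derive1 ?subrK ?(clamped_itv hv)// /clamped clamp_id//; exact: zb.
  have bf : bounded_measurable (fun z => prim L U phi (clamped L U z i) + f L).
    by apply: bounded_measurableD; [exact: bp|exact: bc].
  rewrite wcovD//; [|exact: bp].
  rewrite wcov_cst// addr0 wcovC wcovD//; [|exact: bp..].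
  by rewrite wcov_cst ?addr0 1?wcovC//; exact: bp.
have [w wE] : exists w, w = I W by exists (I W).
have EE F : E F = I (fun z => F z * W z) / w by rewrite wE; exact: gibbs_meanE.
clearbody E; rewrite !EE {EE}; rewrite /kappa -wE in main; rewrite -wE in IW0.
(* If the partition function is [0], the convention [x / 0 = 0] makes the left side vanish. *)
have [w0|wn] := eqVneq w 0.
  have RHS0 x : 0 <= c0 / (beta * (dst i j)%:R `^ s) * Num.sqrt x.
    by rewrite mulr_ge0 ?sqrtr_ge0// divr_ge0 ?mulr_ge0 ?ltW.
  have E0 (x y z : R) : `|x / w - y / w * (z / w)| = 0.
    by rewrite w0 invr0 !mulr0 subrr normr0.
  by rewrite E0 RHS0.
have wp : 0 < w by rewrite lt_neqAle eq_sym wn.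
have I2 (h : R -> R) (a : 'I_n) :
    I (fun z => h (clamp L U (clamp L U (tnth z a))) ^+ 2 * W z) =
    I (fun z => h (tnth z a) ^+ 2 * W z).
  apply: eq_box_int => z zb.
  have cz : clamp L U (tnth z a) = tnth z a by apply: clamp_id; exact: zb.
  by rewrite !cz.
rewrite [X in `|X| <= _](_ : _ = wcov L U W (fun z => f (tnth z i)) (fun z => g (tnth z j))
    / (w ^+ 2)); last by rewrite /wcov -wE; field.
rewrite covE normrM [`|(_ ^+ 2)^-1|]ger0_norm ?invr_ge0 ?exprn_ge0//.
rewrite ler_pdivrMr ?exprn_gt0//; apply: le_trans main _.
rewrite /phi /gamma /clamped (I2 (derive1 f) i) (I2 (derive1 g) j).
have XY0 : 0 <= I (fun z => derive1 f (tnth z i) ^+ 2 * W z) *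
    I (fun z => derive1 g (tnth z j) ^+ 2 * W z).
  by apply: mulr_ge0; apply: box_int_ge0 => z _; rewrite mulr_ge0 ?sqr_ge0.
move: XY0; move: (I (fun z => derive1 f _ ^+ 2 * _)) (I (fun z => derive1 g _ ^+ 2 * _)) => X Y XY0.
have -> : X / w * (Y / w) = X * Y / w ^+ 2 by field.
have -> : Num.sqrt (X * Y / w ^+ 2) = Num.sqrt (X * Y) / w.
  by rewrite sqrtrM// sqrtrV ?exprn_ge0// sqrtr_sqr ger0_norm.
by rewrite le_eqVlt; apply/orP; left; apply/eqP; field; rewrite wn !gt_eqF.
Qed.

End covariance_bound.

(** * Thermodynamic limit *)

Section shift_invariance.
Context (R : realType).

Lemma measurable_coord (i : int) : measurable_fun setT (fun z : config R => z i).
Proof.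
by move=> _ B mB; rewrite setTI; apply: sub_sigma_algebra; exists i, B.
Qed.

Lemma measurable_shift : measurable_fun [set: config R] (@Defs.shift R : config R -> config R).
Proof.
apply: (@measurability _ _ (config R) (config R) setT (@Defs.shift R) (@cylinders R)) => // _ [_ [i [B [mB ->]]] <-].
by rewrite setTI; apply: sub_sigma_algebra; exists (i + 1), B.
Qed.

Lemma measurable_config_box (L U : R) : measurable (config_box L U).
Proof.
have mi i : measurable [set z : config R | L <= z i <= U].
  rewrite (_ : [set z | _] = (fun z : config R => z i) @^-1` `[L, U]).
    by rewrite -[X in measurable X]setTI; exact: measurable_coord.
  by apply/seteqP; split => z /=; rewrite in_itv.
rewrite (_ : config_box L U =
    \bigcap_(k : nat) [set z : config R | L <= z k%:Z <= U] `&`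
    \bigcap_(k : nat) [set z : config R | L <= z (- k%:Z) <= U]).
  by apply: measurableI; exact: bigcapT_measurable.
apply/seteqP; split => z /=.
  by move=> Hz; split => k _; exact: Hz.
move=> [H1 H2] i; case: (intP i) => [|k|k].
- exact: (H1 0%N I).
- exact: (H1 k.+1 I).
- exact: (H2 k.+1 I).
Qed.

Context (L U : R) (mu : probability (config R) R).
Hypothesis mu_shift : forall A : set (config R), measurable A -> mu (@Defs.shift R @^-1` A) = mu A.

Lemma mean_shift (H : config R -> R) : bounded_measurable H ->
  mean L U mu (fun z => H (Defs.shift z)) = mean L U mu H.
Proof.
move=> bH; have mB := measurable_config_box L U.
have boxE : @Defs.shift R @^-1` config_box L U = config_box L U.
  apply/seteqP; split => z /= Hz i; last exact: Hz.
  by have := Hz (i - 1); rewrite /Defs.shift subrK.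
have mH : measurable_fun setT (EFin \o H) by apply/measurable_EFinP; case: bH.
have intH : mu.-integrable (@Defs.shift R @^-1` config_box L U) ((EFin \o H) \o @Defs.shift R).
  rewrite boxE; apply: (@bounded_measurable_integrable _ _ _ mu _ (fun z => H (Defs.shift z))) => //.
    by rewrite (le_lt_trans (probability_le1 _ mB))// ltry.
  exact: (bounded_measurable_comp bH measurable_shift).
rewrite /mean /Rintegral; congr fine; rewrite -[in LHS]boxE.
rewrite -[LHS](integral_pushforward measurable_shift mH intH mB).
apply: eq_measure_integral; first exact: measurable_shift.
by move=> ms A mA _; exact: (mu_shift mA).
Qed.

Hypothesis LU : L <= U.

(** Moves a pair of sites to [1] and [1 + d], the position in which the bulk limit describes a
    block. *)
Lemma mean_translate (f g : R -> R) (d i : int) :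
  (forall x, L <= x <= U -> {for x, continuous f}) ->
  (forall x, L <= x <= U -> {for x, continuous g}) ->
  mean L U mu (fun z => f (z i) * g (z (i + d))) = mean L U mu (fun z => f (z 1) * g (z (1 + d))).
Proof.
move=> cf cg.
pose T k := mean L U mu (fun z => f (z k) * g (z (k + d))).
(* Shift invariance is applied to bounded measurable functions on all configurations; clamping
   provides these and changes nothing on the box. *)
pose Tc k := mean L U mu (fun z => f (clamp L U (z k)) * g (clamp L U (z (k + d)))).
have TE k : T k = Tc k.
  apply: eq_Rintegral => z /set_mem zb.
  by rewrite !clamp_id//; exact: zb.
have TS k : T (k + 1) = T k.
  rewrite !TE /Tc -[RHS]mean_shift; last first.
    apply: bounded_measurableM.
      exact: (bounded_measurable_comp (bounded_measurable_comp_clamp LU cf) (measurable_coord _)).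
    exact: (bounded_measurable_comp (bounded_measurable_comp_clamp LU cg) (measurable_coord _)).
  by congr mean; apply/funext => z; rewrite [k + 1 + d]addrAC.
suff T0 k : T k = T 0 by rewrite -/(T i) -/(T 1) T0 [in RHS]T0.
elim/int_ind : k => [//|k IH|k IH].
  by rewrite -IH -[RHS]TS; congr T; lia.
by rewrite -IH -[LHS]TS; congr T; lia.
Qed.

End shift_invariance.

Lemma smooth_on_pos_continuous (R : realType) (f : R -> R) : smooth_on_pos f ->
  forall x, 0 < x -> [/\ derivable f x 1, {for x, continuous f} & {for x, continuous (derive1 f)}].
Proof.
move=> sf x x0; split; first exact: (sf 0%N).
  by apply/differentiable_continuous/derivable1_diffP; exact: (sf 0%N).
by apply/differentiable_continuous/derivable1_diffP; exact: (sf 1%N).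
Qed.

(** * Passage of the finite-chain bound to the bulk limit *)

Section bulk.
Context (R : realType) (v : R -> \bar R) (m : option nat) (z_min z_max beta p : R).
Context (mu : probability (config R) R).
Local Notation L := z_min.
Local Notation U := z_max.
Hypothesis bulk : bulk_limit v m L U beta p mu.

(** The bulk limit with [i_N = N / 2], which recedes from both ends, for a function of the first and
    last entries of a block of [d + 1] spacings. *)
Lemma cvg_gibbs_mean_pair (d : nat) (f g : R -> R) :
  (forall x, L <= x <= U -> {for x, continuous f}) ->
  (forall x, L <= x <= U -> {for x, continuous g}) ->
  gibbs_mean v m L U beta p (fun z : N.-1.-tuple R => f z`_N./2 * g z`_(N./2 + d))
    @[N --> \oo] --> mean L U mu (fun z => f (z 1) * g (z d.+1%:Z)).
Proof.
move=> cf cg; have [_ _ lim] := bulk.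
pose F (x : 'rV[R]_d.+1) := f (x ord0 ord0) * g (x ord0 ord_max).
have cF : {within row_box L U (k := d.+1), continuous F}.
  apply: continuous_in_subspaceT => x; rewrite inE => xb.
  have cf' : {for x, continuous (fun x : 'rV[R]_d.+1 => f (x ord0 ord0))}.
    apply: (@continuous_comp _ _ _ (fun x : 'rV[R]_d.+1 => x ord0 ord0) f).
      exact: coord_continuous.
    by apply: cf; exact: xb.
  have cg' : {for x, continuous (fun x : 'rV[R]_d.+1 => g (x ord0 ord_max))}.
    apply: (@continuous_comp _ _ _ (fun x : 'rV[R]_d.+1 => x ord0 ord_max) g).
      exact: coord_continuous.
    by apply: cg; exact: xb.
  exact: (continuousM cf' cg').
have cvg_half : half N @[N --> \oo] --> \oo.
  by apply/cvgnyPge => A; exists A.*2 => // N /= AN; lia.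
have cvg_half' : (N - half N)%N @[N --> \oo] --> \oo.
  by apply/cvgnyPge => A; exists A.*2 => // N /= AN; lia.
have := lim d.+1 F half isT cF cvg_half cvg_half'.
rewrite /mean [X in _ --> X -> _](_ : _ =
    \int[mu]_(z in config_box L U) (f (z 1) * g (z d.+1%:Z))); last first.
  by congr Rintegral; apply/funext => z; rewrite /F !mxE.
have -> // : (fun N => gibbs_mean v m L U beta p
      (fun z : N.-1.-tuple R => F (\row_(l < d.+1) z`_(half N + l)%N))) =
    (fun N => gibbs_mean v m L U beta p
      (fun z : N.-1.-tuple R => f z`_N./2 * g z`_(N./2 + d))).
apply/funext => N; congr gibbs_mean.
by apply/funext => z; rewrite /F !mxE addn0.
Qed.

Lemma bulk_cov_le (d : nat) (K : R) (f g : R -> R) : 0 <= L -> L <= U ->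
  (forall x, L <= x <= U -> [/\ {for x, continuous f} & {for x, continuous (derive1 f)}]) ->
  (forall x, L <= x <= U -> [/\ {for x, continuous g} & {for x, continuous (derive1 g)}]) ->
  (forall n (i j : 'I_n), dst i j = d ->
    let E := gibbs_mean v m L U beta p (N := n.+1) in
    `|E (fun z => f (tnth z i) * g (tnth z j))
      - E (fun z => f (tnth z i)) * E (fun z => g (tnth z j))|
    <= K * Num.sqrt (E (fun z => derive1 f (tnth z i) ^+ 2) * E (fun z => derive1 g (tnth z j) ^+ 2))) ->
  `|mean L U mu (fun z => f (z 1) * g (z d.+1%:Z))
    - mean L U mu (fun z => f (z 1)) * mean L U mu (fun z => g (z d.+1%:Z))|
  <= K * Num.sqrt (mean L U mu (fun z => derive1 f (z 1) ^+ 2)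
                   * mean L U mu (fun z => derive1 g (z d.+1%:Z) ^+ 2)).
Proof.
move=> L0 LU cf cg HN.
have c1 (x : R) : L <= x <= U -> {for x, continuous (fun=> 1 : R)}.
  by move=> _; exact: cst_continuous.
have c2 (h : R -> R) : (forall x, L <= x <= U -> {for x, continuous h}) ->
    forall x, L <= x <= U -> {for x, continuous (fun t => h t ^+ 2)}.
  by move=> ch x /ch hx; exact: (continuousM hx hx).
have cf0 x (xI : L <= x <= U) : {for x, continuous f} by have [] := cf x xI.
have cg0 x (xI : L <= x <= U) : {for x, continuous g} by have [] := cg x xI.
have cf1 x (xI : L <= x <= U) : {for x, continuous (derive1 f)} by have [] := cf x xI.
have cg1 x (xI : L <= x <= U) : {for x, continuous (derive1 g)} by have [] := cg x xI.
(* One-point means are pair means whose other function is the constant [1]. *)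
have left (h : R -> R) (ch : forall x, L <= x <= U -> {for x, continuous h}) :
    gibbs_mean v m L U beta p (fun z : N.-1.-tuple R => h z`_N./2) @[N --> \oo]
    --> mean L U mu (fun z => h (z 1)).
  have := cvg_gibbs_mean_pair (d := d) ch c1.
  rewrite (_ : (fun z : config R => h (z 1) * 1) = (fun z => h (z 1))); last first.
    by apply/funext => z; rewrite mulr1.
  have -> // : (fun N => gibbs_mean v m L U beta p (fun z : N.-1.-tuple R => h z`_N./2 * 1)) =
      (fun N => gibbs_mean v m L U beta p (fun z : N.-1.-tuple R => h z`_N./2)).
  apply/funext => N; congr gibbs_mean.
  by apply/funext => z; rewrite mulr1.
have right (h : R -> R) (ch : forall x, L <= x <= U -> {for x, continuous h}) :
    gibbs_mean v m L U beta p (fun z : N.-1.-tuple R => h z`_(N./2 + d)) @[N --> \oo]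
    --> mean L U mu (fun z => h (z d.+1%:Z)).
  have := cvg_gibbs_mean_pair (d := d) c1 ch.
  rewrite (_ : (fun z : config R => 1 * h (z d.+1%:Z)) = (fun z => h (z d.+1%:Z))); last first.
    by apply/funext => z; rewrite mul1r.
  have -> // : (fun N => gibbs_mean v m L U beta p (fun z : N.-1.-tuple R => 1 * h z`_(N./2 + d))) =
      (fun N => gibbs_mean v m L U beta p (fun z : N.-1.-tuple R => h z`_(N./2 + d))).
  apply/funext => N; congr gibbs_mean.
  by apply/funext => z; rewrite mul1r.
have H1 := cvg_gibbs_mean_pair (d := d) cf0 cg0.
have H2 := left _ cf0; have H3 := right _ cg0.
have H4 := left _ (c2 _ cf1); have H5 := right _ (c2 _ cg1).
pose S1 N := gibbs_mean v m L U beta p (fun z : N.-1.-tuple R => f z`_N./2 * g z`_(N./2 + d)).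
pose S2 N := gibbs_mean v m L U beta p (fun z : N.-1.-tuple R => f z`_N./2).
pose S3 N := gibbs_mean v m L U beta p (fun z : N.-1.-tuple R => g z`_(N./2 + d)).
pose S4 N := gibbs_mean v m L U beta p (fun z : N.-1.-tuple R => derive1 f z`_N./2 ^+ 2).
pose S5 N := gibbs_mean v m L U beta p (fun z : N.-1.-tuple R => derive1 g z`_(N./2 + d) ^+ 2).
have lhs : `|S1 N - S2 N * S3 N| @[N --> \oo] -->
    `|mean L U mu (fun z => f (z 1) * g (z d.+1%:Z))
      - mean L U mu (fun z => f (z 1)) * mean L U mu (fun z => g (z d.+1%:Z))|.
  by apply: cvg_norm; apply: cvgB; [exact: H1|apply: cvgM; [exact: H2|exact: H3]].
have rhs : (K * Num.sqrt (S4 N * S5 N)) @[N --> \oo] -->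
    K * Num.sqrt (mean L U mu (fun z => derive1 f (z 1) ^+ 2)
                   * mean L U mu (fun z => derive1 g (z d.+1%:Z) ^+ 2)).
  apply: cvgM; first exact: cvg_cst.
  apply: (@continuous_cvg _ _ _ _ _ (fun N => S4 N * S5 N) (@Num.sqrt R)).
    exact: sqrt_continuous.
  by apply: cvgM; [exact: H4|exact: H5].
apply: (ler_cvg_to lhs rhs).
(* From this size on, both sites [N / 2] and [N / 2 + d] are genuine indices among the [N - 1]
   spacings, and the default value of [nth] is never read. *)
exists (d.*2 + 4)%N => // N /= dN.
case: N dN => [|n] dN; first by lia.
have in1 : ((n.+1)./2 < n)%N by lia.
have jn1 : ((n.+1)./2 + d < n)%N by lia.
have := HN n (Ordinal in1) (Ordinal jn1); rewrite /dst /= => /(_ _) H.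
have E1 (h : R -> R) : (fun z : n.+1.-1.-tuple R => h z`_(n.+1)./2) =
    (fun z => h (tnth z (Ordinal in1))).
  by apply/funext => z; rewrite (tnth_nth 0).
have E2 (h : R -> R) : (fun z : n.+1.-1.-tuple R => h z`_((n.+1)./2 + d)) =
    (fun z => h (tnth z (Ordinal jn1))).
  by apply/funext => z; rewrite (tnth_nth 0).
rewrite /S1 /S2 /S3 /S4 /S5 (E1 f) (E2 g) (E1 (fun t => derive1 f t ^+ 2)) (E2 (fun t => derive1 g t ^+ 2)).
rewrite (_ : (fun z : n.+1.-1.-tuple R => f z`_(n.+1)./2 * g z`_((n.+1)./2 + d)) =
  (fun z => f (tnth z (Ordinal in1)) * g (tnth z (Ordinal jn1)))).
  by apply: H; lia.
by apply/funext => z; rewrite !(tnth_nth 0).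
Qed.

End bulk.

Theorem proposition2p10 (R : realType) (v : R -> \bar R)
    (r_hc z_min z_max alpha1 alpha2 s : R)
    (hv : potential_assumption v r_hc z_min z_max alpha1 alpha2 s)
    (hr : 0 < r_hc)
    (m : option nat) (hm : m <> Some 0%N) :
  exists2 c : R, 0 < c &
    forall (beta p : R), 0 < beta -> 0 < p ->
    forall mu : probability (config R) R,
      bulk_limit v m z_min z_max beta p mu ->
    forall f g : R -> R, smooth_on_pos f -> smooth_on_pos g ->
    forall i j : int, i != j ->
      `| mean z_min z_max mu (fun z => f (z i) * g (z j))
         - mean z_min z_max mu (fun z => f (z i))
           * mean z_min z_max mu (fun z => g (z j)) |
      <= c / (beta * (`|i - j|%:~R) `^ s)
         * Num.sqrt (mean z_min z_max mu (fun z => derive1 f (z i) ^+ 2)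
                     * mean z_min z_max mu (fun z => derive1 g (z j) ^+ 2)).
Proof.
have [c c0 Hc] := gibbs_cov_le hv.
have L0 := zmin_gt0 hv; have LU := zmin_lt_zmax hv.
exists c => // beta p beta0 p0 mu bulk.
have pos x : z_min <= x <= z_max -> 0 < x by move=> /andP[Lx _]; exact: lt_le_trans Lx.
(* The case where the second site lies to the right; the opposite order follows by exchanging [f]
   and [g], the bound being symmetric. *)
have main (f g : R -> R) (i : int) (d : nat) : smooth_on_pos f -> smooth_on_pos g -> (0 < d)%N ->
  `| mean z_min z_max mu (fun z => f (z i) * g (z (i + d%:Z)))
     - mean z_min z_max mu (fun z => f (z i)) * mean z_min z_max mu (fun z => g (z (i + d%:Z))) |
  <= c / (beta * d%:R `^ s)
     * Num.sqrt (mean z_min z_max mu (fun z => derive1 f (z i) ^+ 2)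
                 * mean z_min z_max mu (fun z => derive1 g (z (i + d%:Z)) ^+ 2)).
  move=> sf sg d0.
  have cf x (xI : z_min <= x <= z_max) := smooth_on_pos_continuous sf (pos x xI).
  have cg x (xI : z_min <= x <= z_max) := smooth_on_pos_continuous sg (pos x xI).
  have [_ mu_shift _] := bulk.
  have c1 (x : R) : z_min <= x <= z_max -> {for x, continuous (fun=> 1 : R)}.
    by move=> _; exact: cst_continuous.
  have tr2 (h k : R -> R) (ch : forall x, z_min <= x <= z_max -> {for x, continuous h})
      (ck : forall x, z_min <= x <= z_max -> {for x, continuous k}) :
      mean z_min z_max mu (fun z => h (z i) * k (z (i + d%:Z))) =
      mean z_min z_max mu (fun z => h (z 1) * k (z d.+1%:Z)).
    rewrite (mean_translate mu_shift (ltW LU) d%:Z i ch ck).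
    by rewrite (_ : 1 + d%:Z = d.+1%:Z)//; lia.
  have trl (h : R -> R) (ch : forall x, z_min <= x <= z_max -> {for x, continuous h}) :
      mean z_min z_max mu (fun z => h (z i)) = mean z_min z_max mu (fun z => h (z 1)).
    have := tr2 _ _ ch c1.
    by under [X in mean _ _ _ X = _]eq_fun do rewrite mulr1;
       under [X in _ = mean _ _ _ X]eq_fun do rewrite mulr1.
  have trr (h : R -> R) (ch : forall x, z_min <= x <= z_max -> {for x, continuous h}) :
      mean z_min z_max mu (fun z => h (z (i + d%:Z))) = mean z_min z_max mu (fun z => h (z d.+1%:Z)).
    have := tr2 _ _ c1 ch.
    by under [X in mean _ _ _ X = _]eq_fun do rewrite mul1r;
       under [X in _ = mean _ _ _ X]eq_fun do rewrite mul1r.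
  have c2 (h : R -> R) : (forall x, z_min <= x <= z_max -> {for x, continuous h}) ->
      forall x, z_min <= x <= z_max -> {for x, continuous (fun t => h t ^+ 2)}.
    by move=> ch x /ch hx; exact: (continuousM hx hx).
  have cf0 x (xI : z_min <= x <= z_max) : {for x, continuous f} by have [] := cf x xI.
  have cg0 x (xI : z_min <= x <= z_max) : {for x, continuous g} by have [] := cg x xI.
  have cf1 x (xI : z_min <= x <= z_max) : {for x, continuous (derive1 f)} by have [] := cf x xI.
  have cg1 x (xI : z_min <= x <= z_max) : {for x, continuous (derive1 g)} by have [] := cg x xI.
  rewrite (tr2 _ _ cf0 cg0) (trl _ cf0) (trr _ cg0).
  rewrite (trl _ (c2 _ cf1)) (trr _ (c2 _ cg1)).
  apply: (bulk_cov_le bulk (ltW L0) (ltW LU)).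
  - by move=> x xI; split; [exact: cf0|exact: cf1].
  - by move=> x xI; split; [exact: cg0|exact: cg1].
  (* The finite-chain constant involves the chain only through [dst a b = d], so the same bound
     holds along the whole sequence. *)
  move=> n a b abd; rewrite -abd.
  have ab : a != b by apply/eqP => ab; move: d0; rewrite -abd ab dstnn.
  have df x (xI : z_min <= x <= z_max) : derivable f x 1 by have [] := cf x xI.
  have dg x (xI : z_min <= x <= z_max) : derivable g x 1 by have [] := cg x xI.
  exact: (Hc m beta p n a b f g hm beta0 ab df cf1 dg cg1).
move=> f g sf sg i j ij.
have [ij1|ji1] : (exists2 d : nat, (0 < d)%N & j = i + d%:Z) \/
    (exists2 d : nat, (0 < d)%N & i = j + d%:Z).
  have [ij1|ij1] := leP i j; [left; exists `|j - i|%N|right; exists `|i - j|%N]; lia.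
- have [d d0 ->] := ij1.
  have -> : (`|i - (i + d%:Z)|%:~R : R) = d%:R.
    by rewrite opprD addrA subrr sub0r normrN.
  exact: main.
- have [d d0 ->] := ji1.
  have -> : (`|j + d%:Z - j|%:~R : R) = d%:R by rewrite addrAC subrr add0r.
  have := main g f j d sg sf d0.
  rewrite (mulrC (mean z_min z_max mu (fun z => derive1 g (z j) ^+ 2))
                 (mean z_min z_max mu (fun z => derive1 f (z (j + d%:Z)) ^+ 2))).
  rewrite (mulrC (mean z_min z_max mu (fun z => g (z j)))
                 (mean z_min z_max mu (fun z => f (z (j + d%:Z))))).
  have -> // : (fun z : config R => g (z j) * f (z (j + d%:Z))) =
    (fun z => f (z (j + d%:Z)) * g (z j)).
  by apply/funext => z; rewrite mulrC.
Qed.
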